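(* Let $\alpha\in(0,1)$ be fixed, $K=n^\alpha$, and let $\mathcal{D}$ be a sub-Gaussian distribution on $\mathbb{R}$ such that $\mathbb{E}[Z]=\frac12$ and $\mathbb{E}[Z^2]=\frac12$ when $Z$ has distribution $\mathcal{D}$. Then, as $n\to\infty$, $$\mathbb{E}\left[\Psi^{\mathcal{D}}_K\right]=\mathbb{E}\left[\Psi^{\mathcal{N}(1/2,1/4)}_K\right]+O\left(K^{4/3}(\log n)^{7/6}\right).$$ Furthermore, if $\mathcal{D}$ is the distribution of a bounded random variable, the estimate holds also w.h.p. as $n\to\infty$ for the random variables themselves, as opposed to just their expectations: $$\Psi^{\mathcal{D}}_K=\Psi^{\mathcal{N}(1/2,1/4)}_K+O\left(K^{4/3}(\log n)^{7/6}\right)\quad\text{w.h.p. as } n\to\infty.$$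
   Context: $K=n^\alpha$ is regarded as an integer, i.e. $K=\lfloor n^\alpha\rfloor$. For a probability distribution $\mathcal{D}$ on $\mathbb{R}$ let $Z_{ij}$, $1\le i<j\le n$, be i.i.d. with distribution $\mathcal{D}$; for $S\subset\{1,\dots,n\}$ let $Z_S=\sum_{1\le i<j\le n,\ i,j\in S}Z_{ij}$, and $\Psi^{\mathcal{D}}_K=\max_{S\subset\{1,\dots,n\},\,|S|=K}Z_S$. $\Psi^{\mathcal{N}(1/2,1/4)}_K$ is this quantity when $\mathcal{D}$ is the normal distribution with mean $1/2$ and variance $1/4$. In the w.h.p. statement the two random variables are considered on a common probability space (with any joint law). A distribution is sub-Gaussian if there are constants $C,v>0$ with $\mathbb{P}(|Z|>t)\le Ce^{-vt^2}$ for all $t>0$. ''W.h.p.'' means with probability tending to $1$. Constants hidden in $O(\cdot)$ do not depend on $n$ (they may depend on $\alpha$ and $\mathcal{D}$); the w.h.p. estimate means that for some such constant $C'$ the absolute difference is at most $C'K^{4/3}(\log n)^{7/6}$ with probability tending to $1$. *)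

(* Defs.v *)
From HB Require Import structures.
From mathcomp Require Import all_boot all_order all_algebra.
From mathcomp Require Import all_classical all_reals all_analysis.

Set Implicit Arguments.
Unset Strict Implicit.
Unset Printing Implicit Defensive.

Import Order.TTheory GRing.Theory Num.Theory.
Import numFieldNormedType.Exports.
Local Open Scope classical_set_scope.
Local Open Scope ring_scope.

Definition has_law (R : realType) (d : measure_display) (T : measurableType d)
    (P : probability T R) (X : {RV P >-> R})
    (D : probability (measurableTypeR R) R) : Prop :=
  forall A : set R, measurable A -> distribution P X A = D A.

(* Mutual independence: the product rule over every finite subfamily. *)
Definition mutually_independent (R : realType) (d : measure_display)
    (T : measurableType d) (P : probability T R) (I : finType)
    (X : I -> {RV P >-> R}) : Prop :=
  forall (J : {set I}) (A : I -> set R), (forall i, measurable (A i)) ->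
    P (\bigcap_(i in [set` J]) (X i @^-1` A i)) =
    (\prod_(i in J) P (X i @^-1` A i))%E.

Definition iid (R : realType) (d : measure_display) (T : measurableType d)
    (P : probability T R) (I : finType) (X : I -> {RV P >-> R})
    (D : probability (measurableTypeR R) R) : Prop :=
  mutually_independent X /\ forall i, has_law (X i) D.

Definition sub_gaussian (R : realType) (D : probability (measurableTypeR R) R)
    : Prop :=
  exists C v : R, [/\ 0 < C, 0 < v & forall t : R, 0 < t ->
    (D [set x : R | (t < `|x|)%R] <= (C * expR (- v * t ^+ 2))%:E)%E].

Definition law_of_bounded_rv (R : realType)
    (D : probability (measurableTypeR R) R) : Prop :=
  exists (d : measure_display) (T : measurableType d) (P : probability T R)
         (X : {RV P >-> R}),
    (exists M : R, forall w, `|X w| <= M) /\ has_law X D.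

(* The pairs (i, j) with i < j; the vertices 1, ..., n are shifted to 'I_n. *)
Definition edge (n : nat) : finType := {e : 'I_n * 'I_n | (e.1 < e.2)%N}.

Definition Zsum (R : realType) (n : nat) (z : edge n -> R) (S : {set 'I_n})
    : R :=
  \sum_(e : edge n | ((val e).1 \in S) && ((val e).2 \in S)) z e.

(* When k <= n, the initial value of the iterated maximum is itself the term
   of a k-element set, namely {0, ..., k - 1}. *)
Definition Psi (R : realType) (n k : nat) (z : edge n -> R) : R :=
  \big[Num.max/Zsum z [set i : 'I_n | (i < k)%N]%SET]_(S : {set 'I_n} |
    #|S| == k) Zsum z S.

Definition Ksize (R : realType) (alpha : R) (n : nat) : nat :=
  Num.truncn (n%:R `^ alpha).

Definition rate (R : realType) (alpha : R) (n : nat) : R :=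
  (Ksize alpha n)%:R `^ (4 / 3) * ln n%:R `^ (7 / 6).

(* The second parameter of normal_prob is the standard deviation, so the
   variance is 1/4. *)
Definition normal_half_quarter (R : realType)
    : probability (measurableTypeR R) R :=
  @normal_prob R (1 / 2) (1 / 2).

(* Main.v *)
Require Import Defs.
From HB Require Import structures.
From mathcomp Require Import all_boot all_order all_algebra.
From mathcomp Require Import all_classical all_reals all_analysis.
From mathcomp Require Import measurable_realfun ring lra.

Set Implicit Arguments.
Unset Strict Implicit.
Unset Printing Implicit Defensive.
Import Order.TTheory GRing.Theory Num.Theory.
Import numFieldNormedType.Exports.
Local Open Scope classical_set_scope.
Local Open Scope ring_scope.

(** Write Z_V for the weight of a vertex set V and m = K ^ 2, a bound on the
    number of edges inside a K-subset.

    The maximum over V is replaced by the soft maximum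
    F_b = b^-1 ln (\sum_V exp (b Z_V)), which exceeds it by at most
    ln 'C(n, K) / b <= K ln n / b.  As a function of a single edge weight x, the
    soft maximum is a constant plus b^-1 ln (1 + p (exp (b x) - 1)), where p is
    the Gibbs probability that the edge lies in the random set V when its own
    weight is put to 0 [softmax_upd].  The third derivative is of order
    b ^ 2 * p, and the two laws share their first two moments, so changing the
    law of one edge from the normal one to D moves the expectation of F_b by
    O(b ^ 2 p) [softmax_coordinate_compare].

    The Gibbs probabilities of all edges sum to at most m, but if the edges are
    replaced one after the other in a fixed order, each of them is evaluated at
    a different mixture of the two families.  This is repaired by averaging over
    all sets of already replaced edges [set_average_bound]: an increment
    between two consecutive sizes may be charged to the smaller or to the larger
    set, and one of the two charges is at most 2 m / (N + 1), N being the number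
    of edges.  Hence the expectations of F_b differ by O(b ^ 2 m)
    [softmax_compare].  With b = (ln n / K) ^ (1 / 3) both errors are of order
    K ^ (4 / 3) (ln n) ^ (2 / 3), which is below the rate
    [Psi_expectation_compare].

    For the statement in probability, the Efron-Stein inequality [efron_stein]
    bounds the variance of the maximum: resampling an edge can lower the maximum
    only if the edge lies in an optimal set, and then by at most the change of
    its weight.  Up to an exponentially small part, weights are at most
    2 ln n, so the variance is O(K ^ 2 (ln n) ^ 2) [maxlin_variance], far below
    the square of the rate.  Chebyshev's inequality puts both maxima close to
    their expectations, which are close to each other.

    Independence enters through one principle: an independent family is
    determined in law by its marginals [same_law_Rintegral].  It allows one to
    realize a family on a product space, where freezing all coordinates but one
    is Fubini's theorem [decoupling], and where exchanging a coordinate with an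
    independent copy is a relabelling [swap_Rintegral].  All integrability
    follows from E exp (2 |Z|) < oo, which holds for both laws. *)

Lemma le_of_eq disp (T : porderType disp) (x y : T) : x = y -> (x <= y)%O.
Proof. by move=> ->. Qed.

(** * Families of independent variables *)

Section ProductLaw.
Context {R : realType}.

(** The boxes generating the product sigma-algebra of [I -> R]; they are stable
    under intersection, so a measure is determined by its values on them. *)
Definition cylinders (I : finType) : set (set (I -> R)) :=
  [set B | exists2 A : I -> set R, (forall i, measurable (A i)) &
     B = [set z | forall i, A i (z i)]].

(** The coordinates are independent and the i-th one has law [mu i]. The
    product rule over subfamilies is the case where some of the [A i] are the
    whole line. *)
Definition product_law (I : finType) d (T : measurableType d)
    (P : probability T R) (X : I -> T -> R)
    (mu : I -> probability (measurableTypeR R) R) : Prop :=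
  (forall i, measurable_fun [set: T] (X i)) /\
  forall A : I -> set R, (forall i, measurable (A i)) ->
    P [set w | forall i, A i (X i w)] = (\prod_i mu i (A i))%E.

Definition borel (I : finType) (G : (I -> R) -> R) : Prop :=
  measurable_fun [set: g_sigma_algebraType (@cylinders I)] G.

Lemma measurable_box (I : finType) d (T : measurableType d) (X : I -> T -> R)
    (A : I -> set R) :
  (forall i, measurable_fun [set: T] (X i)) -> (forall i, measurable (A i)) ->
  measurable [set w | forall i, A i (X i w)].
Proof.
move=> mX mA.
have -> : [set w | forall i, A i (X i w)] =
    \bigcap_(i in [set: I]) (X i @^-1` A i).
  apply/seteqP; split => w /= h i; first by move=> _; exact: h.
  exact: (h i Logic.I).
apply: fin_bigcap_measurable; first exact: finite_finset.
by move=> i _; rewrite -[X in measurable X]setTI; apply: mX.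
Qed.

Lemma measurable_vector (I : finType) d (T : measurableType d)
    (X : I -> T -> R) : (forall i, measurable_fun [set: T] (X i)) ->
  measurable_fun [set: T]
    (fun w => (fun i => X i w) : g_sigma_algebraType (@cylinders I)).
Proof.
move=> mX; apply: (@measurability _ _ T (g_sigma_algebraType (@cylinders I))
  _ _ (@cylinders I)) => // _ [_ [A mA ->] <-].
by rewrite setTI; exact: measurable_box.
Qed.

Lemma borel_coord (I : finType) (i : I) : borel (fun z : I -> R => z i).
Proof.
move=> _ B mB; rewrite setTI; apply: sub_sigma_algebra.
exists (fun j => if j == i then B else setT) => [j|]; first by case: ifP.
apply/seteqP; split => z /= h; first by move=> j; case: eqP => // ->.
by move: (h i); rewrite eqxx.
Qed.

Lemma borel_comp (I : finType) d (T : measurableType d) (X : I -> T -> R)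
    (G : (I -> R) -> R) : (forall i, measurable_fun [set: T] (X i)) ->
  borel G -> measurable_fun [set: T] (fun w => G (fun i => X i w)).
Proof.
move=> mX mG.
exact: (measurableT_comp mG (measurable_vector mX)).
Qed.

(** The product rule gives the law of the vector (X i)_i on boxes, which
    determine it: two independent families with the same marginals, possibly on
    different spaces, give the same integral to every Borel functional. *)
Section SameLaw.
Variables (I : finType) (d d' : measure_display).
Variables (T : measurableType d) (T' : measurableType d').
Variables (P : probability T R) (P' : probability T' R).
Variables (X : I -> T -> R) (X' : I -> T' -> R).
Variable mu : I -> probability (measurableTypeR R) R.
Hypotheses (lX : product_law P X mu) (lX' : product_law P' X' mu).

Local Notation RI := (g_sigma_algebraType (@cylinders I)).
Let V : T -> RI := fun w i => X i w.
Let V' : T' -> RI := fun w i => X' i w.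
Let mV : measurable_fun [set: T] V. Proof. exact: measurable_vector lX.1. Qed.
Let mV' : measurable_fun [set: T'] V'.
Proof. exact: measurable_vector lX'.1. Qed.
HB.instance Definition _ := isMeasurableFun.Build _ _ _ _ _ mV.
HB.instance Definition _ := isMeasurableFun.Build _ _ _ _ _ mV'.

Let same_law (B : set RI) : measurable B ->
  pushforward P V B = pushforward P' V' B.
Proof.
move=> mB.
apply: (@measure_unique _ R RI (@cylinders I) (fun=> setT)) => //.
- move=> _ _ [A mA ->] [A' mA' ->]; exists (fun i => A i `&` A' i).
    by move=> i; exact: measurableI.
  apply/seteqP; split => z /=; first by move=> [h h'] i; split.
  by move=> h; split => i; have [] := h i.
- by move=> _; exists (fun=> setT) => //; apply/seteqP; split.
- by apply/seteqP; split => // z _; exists 0%N.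
- by move=> _ [A mA ->]; exact: etrans (lX.2 _ mA) (esym (lX'.2 _ mA)).
- move=> _; rewrite -[X in (X < _)%E]/(P (V @^-1` setT)).
  by rewrite preimage_setT probability_setT ltry.
Qed.

Lemma same_law_ge0_integral (G : (I -> R) -> R) :
  borel G -> (forall z, 0 <= G z) ->
  (\int[P]_w (G (fun i => X i w))%:E = \int[P']_w (G (fun i => X' i w))%:E)%E.
Proof.
move=> mG G0.
have mG' : measurable_fun [set: RI] (EFin \o (G : RI -> R)).
  exact/measurable_EFinP.
transitivity (\int[pushforward P V]_z (G z)%:E)%E.
  by rewrite ge0_integral_pushforward// => z _; rewrite lee_fin.
transitivity (\int[pushforward P' V']_z (G z)%:E)%E; last first.
  by rewrite ge0_integral_pushforward// => z _; rewrite lee_fin.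
by apply: eq_measure_integral => A mA _; exact: same_law.
Qed.

Lemma same_law_integrable (G : (I -> R) -> R) : borel G ->
  P.-integrable setT (EFin \o (fun w => G (fun i => X i w))) ->
  P'.-integrable setT (EFin \o (fun w => G (fun i => X' i w))).
Proof.
move=> mG /integrableP[_ iG]; apply/integrableP; split.
  by apply/measurable_EFinP; exact: borel_comp lX'.1 mG.
have mnG : borel (fun z => `|G z|) by exact: measurableT_comp.
have e := same_law_ge0_integral mnG (fun z => normr_ge0 _).
by apply: le_lt_trans iG; apply: le_of_eq.
Qed.

Lemma same_law_integral (G : (I -> R) -> R) : borel G ->
  P.-integrable setT (EFin \o (fun w => G (fun i => X i w))) ->
  (\int[P]_w (G (fun i => X i w))%:E = \int[P']_w (G (fun i => X' i w))%:E)%E.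
Proof.
move=> mG iG.
have iG' := same_law_integrable mG iG.
have mG' : measurable_fun [set: RI] (EFin \o (G : RI -> R)).
  exact/measurable_EFinP.
transitivity (\int[pushforward P V]_z (G z)%:E)%E.
  by rewrite integral_pushforward.
transitivity (\int[pushforward P' V']_z (G z)%:E)%E; last first.
  by rewrite integral_pushforward.
by apply: eq_measure_integral => A mA _; exact: same_law.
Qed.

Lemma same_law_Rintegral (G : (I -> R) -> R) : borel G ->
  P.-integrable setT (EFin \o (fun w => G (fun i => X i w))) ->
  \int[P]_w G (fun i => X i w) = \int[P']_w G (fun i => X' i w).
Proof. by move=> mG iG; rewrite /Rintegral same_law_integral. Qed.

End SameLaw.

End ProductLaw.

Section Constructions.
Context {R : realType}.
Local Notation law := (probability (measurableTypeR R) R).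

Lemma product_law_iid d (T : measurableType d) (P : probability T R)
    (I : finType) (X : I -> {RV P >-> R}) (D : law) :
  iid X D -> product_law P (fun i => X i) (fun=> D).
Proof.
move=> [indX lawX]; split => [i|A mA]; first exact: measurable_funPT.
have := indX [set: I]%SET A mA.
have -> : \bigcap_(i in [set` [set: I]%SET]) (X i @^-1` A i) =
    [set w | forall i, A i (X i w)].
  apply/seteqP; split => w /= h i; last by move=> _; exact: h.
  by apply: h; rewrite /= inE.
move=> ->; under eq_bigl do rewrite inE.
by apply: eq_bigr => i _; rewrite -(lawX i).
Qed.

Definition pair_family (I J : finType) (T T' : Type) (X : I -> T -> R)
    (Y : J -> T' -> R) (k : I + J) (w : T * T') : R :=
  match k with inl i => X i w.1 | inr j => Y j w.2 end.

Lemma product_law_pair (I J : finType) d d' (T : measurableType d)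
    (T' : measurableType d') (P : probability T R) (P' : probability T' R)
    (X : I -> T -> R) (Y : J -> T' -> R) mu nu :
  product_law P X mu -> product_law P' Y nu ->
  product_law (P \x P')%E (pair_family X Y)
    (fun k => match k with inl i => mu i | inr j => nu j end).
Proof.
move=> [mX pX] [mY pY]; split => [[i|j]|A mA] /=.
- exact: measurableT_comp (mX i) measurable_fst.
- exact: measurableT_comp (mY j) measurable_snd.
have -> : [set w | forall k, A k (pair_family X Y k w)] =
    [set w | forall i, A (inl i) (X i w)] `*`
    [set w | forall j, A (inr j) (Y j w)].
  apply/seteqP; split => w /=; first by move=> h; split=> i;
    [exact: (h (inl i))|exact: (h (inr i))].
  by move=> [h h'] [i|j]; [exact: h|exact: h'].
rewrite product_measure1E; first last.
- exact: (measurable_box (A := fun j => A (inr j)) mY).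
- exact: (measurable_box (A := fun i => A (inl i)) mX).
rewrite big_sumType; congr (_ * _)%E.
- exact: (pX (fun i => A (inl i)) (fun i => mA (inl i))).
- exact: (pY (fun j => A (inr j)) (fun j => mA (inr j))).
Qed.

(** Subfamilies and relabellings of independent families; hybrids, coordinate
    swaps and resampled families are all obtained from a pair of families in
    this way. *)
Lemma product_law_inj (I K : finType) d (T : measurableType d)
    (P : probability T R) (X : I -> T -> R) mu (tau : K -> I) :
  injective tau -> product_law P X mu ->
  product_law P (fun k => X (tau k)) (fun k => mu (tau k)).
Proof.
move=> tau_inj [mX pX]; split => [k|A mA]; first exact: mX.
(* Coordinates outside the range of tau are left unconstrained. *)
pose A' i := if [pick k | tau k == i] is Some k then A k else setT.
have A'tau k : A' (tau k) = A k.
  rewrite /A'; case: pickP => [k' /eqP /tau_inj -> //|/(_ k)].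
  by rewrite eqxx.
have mA' i : measurable (A' i) by rewrite /A'; case: pickP.
have -> : [set w | forall k, A k (X (tau k) w)] =
    [set w | forall i, A' i (X i w)].
  apply/seteqP; split => w /= h i; last by rewrite -A'tau; exact: h.
  by rewrite /A'; case: pickP => // k /eqP <-.
rewrite pX// (bigID (mem (codom tau)))/=.
rewrite [X in (_ * X)%E]big1 ?mule1; last first.
  move=> i ci; rewrite /A'; case: pickP => [k /eqP ki|_].
    by move: ci; rewrite -ki codom_f.
  exact: probability_setT.
have uc : uniq (codom tau) by rewrite map_inj_uniq ?enum_uniq.
rewrite -big_uniq//= big_map big_enum/=.
by apply: eq_bigr => k _; rewrite A'tau.
Qed.

Lemma product_law_single (D : law) :
  product_law D (fun (_ : unit) (x : R) => x) (fun=> D).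
Proof.
split => [_|A mA]; first exact: measurable_id.
rewrite (big_pred1 tt); last by case.
by congr (D _); apply/seteqP; split => x /= h; [exact: h|case].
Qed.

Lemma eq_product_law (I : finType) d (T : measurableType d)
    (P : probability T R) (X X' : I -> T -> R) (mu mu' : I -> law) :
  (forall i w, X i w = X' i w) -> (forall i, mu i = mu' i) ->
  product_law P X mu -> product_law P X' mu'.
Proof.
move=> eX emu; have -> : X' = X by apply/funext => i; apply/funext => w.
by have -> : mu' = mu by apply/funext => i.
Qed.

Lemma product_law_fst (I J : finType) d d' (T : measurableType d)
    (T' : measurableType d') (P : probability T R) (P' : probability T' R)
    (X : I -> T -> R) (Y : J -> T' -> R) mu nu :
  product_law P X mu -> product_law P' Y nu ->
  product_law (P \x P')%E (fun i w => X i w.1) mu.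
Proof.
move=> lX lY; have inj : injective (@inl I J) by move=> i j [].
exact: product_law_inj inj (product_law_pair lX lY).
Qed.

Lemma product_law_snd (I J : finType) d d' (T : measurableType d)
    (T' : measurableType d') (P : probability T R) (P' : probability T' R)
    (X : I -> T -> R) (Y : J -> T' -> R) mu nu :
  product_law P X mu -> product_law P' Y nu ->
  product_law (P \x P')%E (fun j w => Y j w.2) nu.
Proof.
move=> lX lY; have inj : injective (@inr I J) by move=> i j [].
exact: product_law_inj inj (product_law_pair lX lY).
Qed.

Definition upd (I : finType) (z : I -> R) (e : I) (x : R) : I -> R :=
  fun i => if i == e then x else z i.

Section Decoupling.
Variables (I : finType) (d : measure_display) (T : measurableType d).
Variables (P : probability T R) (X : I -> T -> R) (mu : I -> law) (e : I).
Hypothesis lX : product_law P X mu.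

(** Coordinate [e] may be redrawn from its law, on a second factor of the
    space, without changing the law of the family. *)
Lemma product_law_upd :
  product_law (P \x mu e)%E
    (fun i w => upd (fun i => X i w.1) e w.2 i) mu.
Proof.
have lid := product_law_single (mu e).
pose tau i : I + unit := if i == e then inr tt else inl i.
have tau_inj : injective tau.
  by move=> i j; rewrite /tau; case: eqP => [->|_]; case: eqP => [->|_]// [].
apply: eq_product_law (product_law_inj tau_inj (product_law_pair lX lid)).
- by move=> i w; rewrite /tau /upd; case: eqP.
- by move=> i; rewrite /tau; case: eqP => [->|].
Qed.

(** Conditioning on all the coordinates but [e]: after the coordinate has been
    moved to a second factor, this is Fubini's theorem. *)
Lemma decoupling (G : (I -> R) -> R) : borel G ->
  P.-integrable setT (EFin \o (fun w => G (fun i => X i w))) ->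
  (forall z, (mu e).-integrable setT (EFin \o (fun x => G (upd z e x)))) ->
  P.-integrable setT
    (EFin \o (fun w => \int[mu e]_x G (upd (fun i => X i w) e x))) /\
  \int[P]_w G (fun i => X i w) =
  \int[P]_w \int[mu e]_x G (upd (fun i => X i w) e x).
Proof.
move=> mG iG iz.
have iprod := same_law_integrable lX product_law_upd mG iG.
have inner w : (\int[mu e]_x (G (upd (fun i => X i w) e x))%:E)%E =
    (\int[mu e]_x G (upd (fun i => X i w) e x))%:E.
  by rewrite /Rintegral fineK//; apply: integrable_fin_num => //; exact: iz.
split.
  have := integrable_fubini_F iprod.
  by apply: eq_integrable => // w _; exact: inner.
rewrite (same_law_Rintegral lX product_law_upd mG iG).
rewrite {1 2}/Rintegral -integral12_prod_meas1//; congr fine.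
by apply: eq_integral => w _; exact: inner.
Qed.

End Decoupling.
End Constructions.

(** * The soft maximum as a function of one weight *)

Section Softplus.
Context {R : realType}.
Implicit Types (p t u x b : R).

Lemma mean_value_bound (f df : R -> R) (u C : R) :
  (forall t, is_derive t 1 f (df t)) ->
  (forall t, `|t| <= `|u| -> `|df t| <= C) -> `|f u - f 0| <= C * `|u|.
Proof.
move=> fdf dfC.
have cf (a b : R) : {within `[a, b], continuous f}.
  apply: continuous_subspaceT => t; apply: differentiable_continuous.
  by apply/derivable1_diffP; case: (fdf t).
have [u0|u0] := leP 0 u.
  have [t /itvP tu ->] := MVT_segment u0 (fun t _ => fdf t) (@cf _ _).
  by rewrite subr0 normrM ler_wpM2r// dfC// !ger0_norm ?tu.
have [t /itvP tu] := MVT_segment (ltW u0) (fun t _ => fdf t) (@cf _ _).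
rewrite distrC => ->; rewrite sub0r normrM normrN ler_wpM2r// dfC//.
by rewrite !ler0_norm ?tu ?(ltW u0)// lerN2 tu.
Qed.

(** The derivative at [t] of ln (1 + p (exp t - 1)): the probability [p] of an
    event after tilting by the weight exp t on that event. *)
Definition tilt p t : R := p * expR t / (1 + p * (expR t - 1)).

Section Taylor.
Variable p : R.
Hypotheses (p0 : 0 <= p) (p1 : p <= 1).

Lemma tilt_den_gt0 t : 0 < 1 + p * (expR t - 1).
Proof.
have [->|pn0] := eqVneq p 0; first by rewrite mul0r addr0.
have pe : 0 < p * expR t by rewrite mulr_gt0 ?expR_gt0// lt0r pn0.
by have := p1; lra.
Qed.

Lemma tilt_ge0 t : 0 <= tilt p t.
Proof. by rewrite divr_ge0 ?mulr_ge0 ?expR_ge0// ltW ?tilt_den_gt0. Qed.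

Lemma tilt_le1 t : tilt p t <= 1.
Proof. by rewrite ler_pdivrMr ?tilt_den_gt0//; have P1 := p1; nra. Qed.

(** For t >= 0 the denominator is at least 1; for t < 0 it is at least exp
    t. *)
Lemma tilt_le t : tilt p t <= p * expR `|t|.
Proof.
have P0 := p0; have P1 := p1.
rewrite ler_pdivrMr ?tilt_den_gt0//.
have [t0|t0] := leP 0 t.
  have : 1 <= expR t by rewrite -expR0 ler_expR.
  move=> e1; rewrite ger0_norm// ler_peMr//; last by nra.
  by rewrite mulr_ge0 ?expR_ge0.
rewrite ltr0_norm// expRN -mulrA ler_wpM2l//.
have e1 : expR t <= 1 by rewrite -expR0 ler_expR ltW.
have e0 := expR_gt0 t.
rewrite mulrC ler_pdivlMr//; nra.
Qed.

(** For t >= 0 the tilt can only increase [p], and for t < 0 the denominator is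
    at most 1. *)
Lemma tilt_ge t : p * (1 - `|t|) <= tilt p t.
Proof.
have P0 := p0; have P1 := p1.
rewrite ler_pdivlMr ?tilt_den_gt0// -mulrA ler_wpM2l//.
have := tilt_den_gt0 t; set D := 1 + _ => D0.
have e0 := expR_gt0 t; have et := expR_ge1Dx t.
have [t0|t0] := leP 0 t.
  have e1 : 1 <= expR t by rewrite -expR0 ler_expR.
  rewrite ger0_norm//; have : D <= expR t by rewrite /D; nra.
  by nra.
have e1 : expR t <= 1 by rewrite -expR0 ler_expR ltW.
have D1 : D <= 1 by rewrite /D; nra.
by rewrite ltr0_norm// opprK; have [|] := leP 0 (1 + t); nra.
Qed.

Let is_derive_den t :
  is_derive t 1 (fun t => 1 + p * (expR t - 1)) (p * expR t).
Proof.
by apply: is_derive_eq; rewrite add0r mul1r subr0.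
Qed.

Lemma is_derive_softplus t :
  is_derive t 1 (fun t => ln (1 + p * (expR t - 1))) (tilt p t).
Proof.
have den := is_derive_den t.
have lnD := is_derive1_ln (tilt_den_gt0 t).
apply: is_derive_eq.
by rewrite /tilt mulrC.
Qed.

Lemma is_derive_tilt t :
  is_derive t 1 (tilt p) (tilt p t * (1 - tilt p t)).
Proof.
have den := is_derive_den t.
have den0 := lt0r_neq0 (tilt_den_gt0 t).
have tiltE : tilt p =
    (fun t => p * expR t) * (fun t => (1 + p * (expR t - 1))^-1).
  by apply/funext.
have inv := is_deriveV (f := fun t => 1 + p * (expR t - 1)) den0.
rewrite [X in is_derive _ _ X _]tiltE; apply: is_derive_eq.
by rewrite /tilt /GRing.scale /=; field.
Qed.

(** The derivatives of q = tilt p are q (1 - q) and q (1 - q) (1 - 2 q); the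
    last one is at most q in absolute value, hence at most p exp |u| on [-|u|,
    |u|]. Three applications of the mean value inequality integrate this
    bound. *)
Lemma softplus_taylor u :
  `|ln (1 + p * (expR u - 1)) - p * u - p * (1 - p) / 2 * u ^+ 2| <=
  p * expR `|u| * `|u| ^+ 3.
Proof.
set q := tilt p; set M := p * expR `|u|.
have P0 := p0; have P1 := p1.
have M0 : 0 <= M by rewrite mulr_ge0 ?expR_ge0.
have q0 : q 0 = p by rewrite /q /tilt expR0; field.
have q_bound t : `|t| <= `|u| ->
    `|q t * (1 - q t) * (1 - q t) - q t * (q t * (1 - q t))| <= M.
  move=> tu; have qle : q t <= M.
    by apply: le_trans (tilt_le t) _; rewrite ler_wpM2l// ler_expR.
  have := tilt_ge0 t; have := tilt_le1 t; rewrite -/q => h1 h0.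
  rewrite -mulrA -mulrBr normrM ger0_norm//.
  have : `|(1 - q t) * (1 - q t) - q t * (1 - q t)| <= 1.
    by rewrite ler_norml; apply/andP; split; nra.
  by move: qle; nra.
have dq2 t : is_derive t 1 (fun t => q t * (1 - q t))
    (q t * (1 - q t) * (1 - q t) - q t * (q t * (1 - q t))).
  have dq := is_derive_tilt t.
  by apply: is_derive_eq; rewrite /GRing.scale /= -/q; ring.
have B1 t : `|t| <= `|u| -> `|q t * (1 - q t) - p * (1 - p)| <= M * `|u|.
  move=> tu; have := mean_value_bound dq2 (u := t) (C := M).
  rewrite q0 => /(_ (fun s st => q_bound s (le_trans st tu))) /le_trans; apply.
  by rewrite ler_wpM2l.
have df1 t : is_derive t 1 (fun t => q t - p * (1 - p) * t)
    (q t * (1 - q t) - p * (1 - p)).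
  have dq := is_derive_tilt t.
  by apply: is_derive_eq; rewrite /GRing.scale /= -/q; ring.
have B2 t : `|t| <= `|u| ->
    `|q t - p - p * (1 - p) * t| <= M * `|u| ^+ 2.
  move=> tu; have := mean_value_bound df1 (u := t) (C := M * `|u|).
  rewrite q0 mulr0 subr0 => /(_ (fun s st => B1 s (le_trans st tu))).
  rewrite addrAC => /le_trans; apply.
  by rewrite expr2 mulrA ler_wpM2l// mulr_ge0.
have dL t : is_derive t 1
    (fun t => ln (1 + p * (expR t - 1)) - p * t - p * (1 - p) / 2 * t ^+ 2)
    (q t - p - p * (1 - p) * t).
  have dsp := is_derive_softplus t.
  by apply: is_derive_eq; rewrite /GRing.scale /= -/q; field.
have := mean_value_bound dL B2.
rewrite expR0 subrr !mulr0 addr0 ln1 expr0n /= !mulr0 !subr0.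
move=> /le_trans; apply.
by rewrite -mulrA -exprSr.
Qed.

End Taylor.

Lemma cube_le_expR x : 0 <= x -> x ^+ 3 <= 27 * expR x.
Proof.
move=> x0; have -> : expR x = expR (x / 3) ^+ 3.
  by rewrite -expRM_natl; congr expR; field.
have -> : x ^+ 3 = 27 * (x / 3) ^+ 3 by field.
have := expR_ge1Dx (x / 3) => h.
by rewrite ler_wpM2l// lerXn2r ?nnegrE ?expR_ge0//; lra.
Qed.

(** The factor [p] in the remainder is what makes the errors of all the edges
    summable. *)
Lemma scaled_softplus_taylor p b x : 0 <= p <= 1 -> 0 < b <= 1 ->
  `|b^-1 * ln (1 + p * (expR (b * x) - 1)) -
    (p * x + b * (p * (1 - p)) / 2 * x ^+ 2)| <=
  27 * b ^+ 2 * p * expR (2 * `|x|).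
Proof.
move=> /andP[p0 p1] /andP[b0 b1].
have := softplus_taylor p0 p1 (b * x).
rewrite normrM (gtr0_norm b0) => h.
have -> : b^-1 * ln (1 + p * (expR (b * x) - 1)) -
    (p * x + b * (p * (1 - p)) / 2 * x ^+ 2) =
    b^-1 * (ln (1 + p * (expR (b * x) - 1)) - p * (b * x) -
             p * (1 - p) / 2 * (b * x) ^+ 2).
  by field; exact: lt0r_neq0.
rewrite normrM gtr0_norm ?invr_gt0// ler_pdivrMl//.
apply: le_trans h _.
have -> : b * (27 * b ^+ 2 * p * expR (2 * `|x|)) =
   p * expR `|x| * (b ^+ 3 * (27 * expR `|x|)).
  by rewrite (_ : 2 * `|x| = `|x| + `|x|) ?expRD; ring.
rewrite exprMn ler_pM//.
- by rewrite mulr_ge0 ?expR_ge0.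
- by rewrite mulr_ge0 ?exprn_ge0 ?(ltW b0).
- by rewrite ler_wpM2l// ler_expR ler_piMl.
- by rewrite ler_wpM2l ?exprn_ge0 ?(ltW b0)// cube_le_expR.
Qed.

(** A quadratic minorant, so that its integral only involves the second
    moment. *)
Lemma tilt_ge_quadratic p b x : 0 <= p <= 1 -> 0 < b <= 1 ->
  p * (1 / 2 - x ^+ 2 / 2) <= tilt p (b * x).
Proof.
move=> /andP[p0 p1] /andP[b0 b1].
apply: le_trans (tilt_ge p0 p1 (b * x)); rewrite ler_wpM2l//.
rewrite normrM (gtr0_norm b0) -real_normK ?num_real//.
set y := `|x|; have y0 : 0 <= y by exact: normr_ge0.
have : 0 <= (1 - b) * y by rewrite mulr_ge0// subr_ge0.
have := sqr_ge0 (1 - y); rewrite sqrrB; nra.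
Qed.

End Softplus.

(** * Averaging over the sets of replaced coordinates *)

Section SetAverages.
Context {R : realType}.
Variable I : finType.
Local Notation N := #|I|.

Lemma add_remove_double_count (F : I -> {set I} -> R) k :
  \sum_(A : {set I} | #|A| == k) \sum_(e | e \notin A) F e (e |: A)%SET =
  \sum_(B : {set I} | #|B| == k.+1) \sum_(e | e \in B) F e B.
Proof.
rewrite (exchange_big_dep xpredT)//= [RHS](exchange_big_dep xpredT)//=.
apply: eq_bigr => e _.
rewrite [RHS](reindex_onto (fun A => e |: A)%SET (fun B => B :\ e)%SET)/=.
  apply: eq_bigl => A; rewrite setU11 andbT cardsU1.
  have [eA|eA] /= := boolP (e \in A).
    rewrite andbF; symmetry; apply/negbTE/negP => /andP[_ /eqP h].
    by move: eA; rewrite -h !inE eqxx.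
  by rewrite add1n eqSS finset.setU1K// eqxx !andbT.
by move=> B /andP[_ eB]; rewrite finset.setD1K.
Qed.

(** Let a k be the average of [h] over the sets of size k. Up to normalization,
    a (k + 1) - a k is the sum of the increments of [h] over pairs (A, e) with
    e \notin A. Charging them to A gives |a (k + 1) - a k| <= m / (N - k), and
    charging them to e |: A gives m / (k + 1); the smaller of the two is at
    most 2 m / (N + 1), and there are N increments. *)
Lemma set_average_bound (h : {set I} -> R) (q : I -> {set I} -> R) (m : R) :
  (forall e A, 0 <= q e A) ->
  (forall (e : I) (A : {set I}), e \notin A ->
    `|h (e |: A)%SET - h A| <= Num.min (q e A) (q e (e |: A)%SET)) ->
  (forall A, \sum_e q e A <= m) ->
  `|h [set: I]%SET - h finset.set0| <= 2 * m.
Proof.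
move=> q0 hq qm.
have m0 : 0 <= m by apply: le_trans (qm finset.set0); apply: sumr_ge0.
pose a k := (\sum_(A : {set I} | #|A| == k) h A) / 'C(N, k)%:R.
have card_k k : \sum_(A : {set I} | #|A| == k) m = m * 'C(N, k)%:R.
  rewrite sumr_const mulr_natr; congr (_ *+ _).
  by rewrite -card_draws; apply: eq_card => A; rewrite !inE.
have step k : (k < N)%N -> `|a k.+1 - a k| <= 2 * m / N.+1%:R.
  move=> kN.
  (* [w] is the number of pairs (A, e), counted through e |: A or through A. *)
  pose w : R := k.+1%:R * 'C(N, k.+1)%:R.
  have wE : w = (N - k)%:R * 'C(N, k)%:R.
    by rewrite /w -!natrM mul_bin_left mulnC.
  have C1 : 0 < 'C(N, k.+1)%:R :> R by rewrite ltr0n bin_gt0.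
  have C0 : 0 < 'C(N, k)%:R :> R by rewrite ltr0n bin_gt0 ltnW.
  have Nk : 0 < (N - k)%:R :> R by rewrite ltr0n subn_gt0.
  have w0 : 0 < w by rewrite mulr_gt0.
  have aE : a k.+1 - a k = (\sum_(A : {set I} | #|A| == k)
      \sum_(e | e \notin A) (h (e |: A)%SET - h A)) / w.
    under [X in _ = X / _]eq_bigr do rewrite sumrB.
    rewrite sumrB (add_remove_double_count (fun _ => h)) mulrBl; congr (_ - _).
      rewrite /a /w.
      under [X in _ = X / _]eq_bigr => B /eqP Bk do
        rewrite sumr_const Bk -mulr_natl.
      by rewrite -big_distrr /= -mulf_div divff ?mul1r.
    rewrite /a wE.
    under [X in _ = X / _]eq_bigr => A /eqP Ak.
      rewrite sumr_const (_ : #|_| = (N - k)%N).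
        rewrite -mulr_natl; over.
      by rewrite -Ak -(cardsC A) addKn; apply: eq_card => e; rewrite !inE.
    by rewrite -big_distrr /= -mulf_div divff ?mul1r// gt_eqF.
  have le_l : `|a k.+1 - a k| * w <= m * 'C(N, k)%:R.
    rewrite aE normrM normfV (gtr0_norm w0) divfK ?gt_eqF//.
    rewrite -card_k; apply: le_trans (ler_norm_sum _ _ _) _.
    apply: ler_sum => A _; apply: le_trans (ler_norm_sum _ _ _) _.
    apply: le_trans (qm A); rewrite [leRHS](bigID (fun e => e \notin A))/=.
    rewrite -[leLHS]addr0 lerD ?sumr_ge0//; apply: ler_sum => e eA.
    by apply: le_trans (hq _ _ eA) _; rewrite ge_min lexx.
  have le_r : `|a k.+1 - a k| * w <= m * 'C(N, k.+1)%:R.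
    rewrite aE normrM normfV (gtr0_norm w0) divfK ?gt_eqF//.
    rewrite -card_k; apply: le_trans (ler_norm_sum _ _ _) _.
    apply: (@le_trans _ _ (\sum_(A : {set I} | #|A| == k)
      \sum_(e | e \notin A) q e (e |: A)%SET)).
      apply: ler_sum => A _; apply: le_trans (ler_norm_sum _ _ _) _.
      apply: ler_sum => e eA.
      by apply: le_trans (hq _ _ eA) _; rewrite ge_min lexx orbT.
    rewrite add_remove_double_count; apply: ler_sum => B _.
    apply: le_trans (qm B); rewrite [leRHS](bigID (mem B))/=.
    by rewrite lerDl sumr_ge0.
  have {}le_l : `|a k.+1 - a k| * (N - k)%:R <= m.
    by rewrite -(ler_pM2r C0) -mulrA -wE.
  have {}le_r : `|a k.+1 - a k| * k.+1%:R <= m.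
    by rewrite -(ler_pM2r C1) -mulrA.
  rewrite ler_pdivlMr ?ltr0n//.
  have -> : N.+1%:R = (N - k)%:R + k.+1%:R :> R.
    by rewrite -natrD addnS subnK// ltnW.
  by rewrite mulrDr [2 * m]mulr_natl mulr2n lerD.
have aN : a N = h [set: I]%SET.
  rewrite /a binn divr1 (big_pred1 [set: I]%SET)// => A /=.
  by rewrite eqEcard finset.subsetT cardsT /= eqn_leq max_card.
have a0 : a 0%N = h finset.set0.
  by rewrite /a bin0 divr1 (big_pred1 finset.set0)// => A /=; rewrite cards_eq0.
rewrite -aN -a0 -telescope_sumr//; apply: le_trans (ler_norm_sum _ _ _) _.
rewrite big_mkord; apply: (@le_trans _ _ (\sum_(i < N) 2 * m / N.+1%:R)).
  by apply: ler_sum => i _; exact: step.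
rewrite sumr_const card_ord -[leLHS]mulr_natr -mulrA ler_piMr ?mulr_ge0//.
by rewrite mulrC ler_pdivrMr ?ltr0n// mul1r ler_nat.
Qed.

End SetAverages.

(** * The soft maximum and its Gibbs measure *)

Section SoftMax.
Context {R : realType}.
Variables (I J : finType) (S : pred J) (A : J -> pred I) (j0 : J).
Implicit Types (z : I -> R) (b : R) (e : I).

(** The candidates [j] with [S j] are weighted by the sum of the coordinates in
    [A j]; the k-subsets of vertices will be the candidates, and [A j] the
    edges inside such a subset. *)
Definition lin z (j : J) : R := \sum_(i | A j i) z i.

Definition maxlin z : R := \big[Num.max/lin z j0]_(j | S j) lin z j.

Definition partition_fun b z : R := \sum_(j | S j) expR (b * lin z j).

Definition softmax b z : R := b^-1 * ln (partition_fun b z).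

(** The probability that [A j] contains [e], when [j] is drawn with probability
    proportional to exp (b * lin z j). *)
Definition gibbs b z e : R :=
  (\sum_(j | S j && A j e) expR (b * lin z j)) / partition_fun b z.

Hypothesis Sj0 : S j0.

Lemma partition_fun_gt0 b z : 0 < partition_fun b z.
Proof.
rewrite /partition_fun (bigD1 j0)//= ltr_pwDl ?expR_gt0//.
by apply: sumr_ge0 => j _; exact: expR_ge0.
Qed.

Lemma lin_le_maxlin z j : S j -> lin z j <= maxlin z.
Proof. by move=> Sj; rewrite /maxlin; exact: le_bigmax_cond. Qed.

Lemma maxlin_attained z : exists2 j, S j & maxlin z = lin z j.
Proof.
rewrite /maxlin; elim/big_ind : _ => [|x y [j Sj ->] [k Sk ->]|j Sj].
- by exists j0.
- by rewrite /Num.max; case: ifP => _; [exists k|exists j].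
- by exists j.
Qed.

Lemma softmax_ge_maxlin b z : 0 < b -> maxlin z <= softmax b z.
Proof.
move=> b0; have [j Sj ->] := maxlin_attained z.
rewrite /softmax mulrC ler_pdivlMr// -[leLHS]expRK ler_ln ?posrE ?expR_gt0//.
  rewrite /partition_fun mulrC (bigD1 j)//= lerDl.
  by apply: sumr_ge0 => k _; exact: expR_ge0.
exact: partition_fun_gt0.
Qed.

Lemma softmax_le_maxlin b z : 0 < b ->
  softmax b z <= maxlin z + ln #|S|%:R / b.
Proof.
move=> b0; rewrite /softmax mulrC ler_pdivrMr// mulrDl divfK ?gt_eqF//.
have S0 : 0 < #|S|%:R :> R by rewrite ltr0n; apply/card_gt0P; exists j0.
rewrite -{1}[maxlin z * b]expRK -lnM ?posrE ?expR_gt0//.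
rewrite ler_ln ?posrE ?mulr_gt0 ?expR_gt0 ?partition_fun_gt0//.
rewrite mulr_natr -sumr_const; apply: ler_sum => j Sj.
by rewrite ler_expR mulrC ler_pM2r// lin_le_maxlin.
Qed.

Lemma gibbs_ge0 b z e : 0 <= gibbs b z e.
Proof.
rewrite divr_ge0 ?(ltW (partition_fun_gt0 _ _))//.
by apply: sumr_ge0 => j _; exact: expR_ge0.
Qed.

Lemma gibbs_le1 b z e : gibbs b z e <= 1.
Proof.
rewrite ler_pdivrMr ?partition_fun_gt0// mul1r /partition_fun.
rewrite [leRHS](bigID (A ^~ e))/= lerDl.
by apply: sumr_ge0 => j _; exact: expR_ge0.
Qed.

(** The sum is the expected cardinal of [A j]. *)
Lemma sum_gibbs_le b z (m : nat) : (forall j, S j -> (#|A j| <= m)%N) ->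
  \sum_e gibbs b z e <= m%:R.
Proof.
move=> Am; rewrite -big_distrl/= ler_pdivrMr ?partition_fun_gt0//.
rewrite (exchange_big_dep S)/=; last by move=> e j _ /andP[].
rewrite /partition_fun mulr_sumr; apply: ler_sum => j Sj.
under eq_bigl do rewrite Sj.
by rewrite sumr_const -[leLHS]mulr_natl ler_wpM2r ?expR_ge0// ler_nat Am.
Qed.

Lemma lin_upd z e x j : lin (upd z e x) j = lin (upd z e 0) j + (A j e)%:R * x.
Proof.
rewrite /lin; have [Aje|nAje] := boolP (A j e); last first.
  rewrite mul0r addr0; apply: eq_bigr => i Aji; rewrite /upd.
  by case: eqP => // ie; move: nAje; rewrite -ie Aji.
rewrite (bigD1 e)//= [in RHS](bigD1 e)//= /upd eqxx mul1r add0r addrC.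
by congr (_ + _); apply: eq_bigr => i /andP[_ /negbTE ->].
Qed.

Lemma sum_expR_upd_in b z e x :
  \sum_(j | S j && A j e) expR (b * lin (upd z e x) j) =
  expR (b * x) * \sum_(j | S j && A j e) expR (b * lin (upd z e 0) j).
Proof.
rewrite mulr_sumr; apply: eq_bigr => j /andP[_ Aje].
by rewrite lin_upd Aje mul1r mulrDr expRD mulrC.
Qed.

(** Changing the weight of [e] from 0 to [x] multiplies by exp (b x) the terms
    of the candidates containing [e], a proportion [gibbs] of the total. *)
Lemma partition_fun_upd b z e x : partition_fun b (upd z e x) =
  partition_fun b (upd z e 0) *
  (1 + gibbs b (upd z e 0) e * (expR (b * x) - 1)).
Proof.
rewrite {1}/partition_fun (bigID (A ^~ e))/= sum_expR_upd_in.
rewrite mulrDr mulr1 mulrA [partition_fun _ _ * gibbs _ _ _]mulrC.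
rewrite divfK ?gt_eqF ?partition_fun_gt0//.
have -> : \sum_(j | S j && ~~ A j e) expR (b * lin (upd z e x) j) =
    partition_fun b (upd z e 0) -
    \sum_(j | S j && A j e) expR (b * lin (upd z e 0) j).
  rewrite /partition_fun [X in _ = X - _](bigID (A ^~ e))/= addrAC subrr add0r.
  by apply: eq_bigr => j /andP[_ /negbTE Aje]; rewrite lin_upd Aje mul0r addr0.
by ring.
Qed.

Lemma softmax_upd b z e x : softmax b (upd z e x) = softmax b (upd z e 0) +
  b^-1 * ln (1 + gibbs b (upd z e 0) e * (expR (b * x) - 1)).
Proof.
have t0 := tilt_den_gt0 (gibbs_ge0 b (upd z e 0) e) (gibbs_le1 _ _ _) (b * x).
by rewrite /softmax partition_fun_upd lnM ?posrE ?partition_fun_gt0// mulrDr.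
Qed.

Lemma gibbs_upd b z e x :
  gibbs b (upd z e x) e = tilt (gibbs b (upd z e 0) e) (b * x).
Proof.
have p0 := partition_fun_gt0 b (upd z e 0).
have t0 := tilt_den_gt0 (gibbs_ge0 b (upd z e 0) e) (gibbs_le1 _ _ _) (b * x).
rewrite {1}/gibbs partition_fun_upd sum_expR_upd_in /tilt.
set g := gibbs b _ _ in t0 *.
have -> : \sum_(j | S j && A j e) expR (b * lin (upd z e 0) j) =
    g * partition_fun b (upd z e 0) by rewrite divfK ?gt_eqF.
by field; rewrite !gt_eqF.
Qed.

Lemma norm_lin_le z j : `|lin z j| <= \sum_i `|z i|.
Proof.
apply: le_trans (ler_norm_sum _ _ _) _.
by rewrite [leRHS](bigID (A j))/= lerDl sumr_ge0.
Qed.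

Lemma norm_maxlin_le z : `|maxlin z| <= \sum_i `|z i|.
Proof. by have [j _ ->] := maxlin_attained z; exact: norm_lin_le. Qed.

Lemma ln_card_ge0 : 0 <= ln #|S|%:R :> R.
Proof. by rewrite ln_ge0// ler1n; apply/card_gt0P; exists j0. Qed.

Lemma norm_softmax_le b z : 0 < b ->
  `|softmax b z| <= \sum_i `|z i| + ln #|S|%:R / b.
Proof.
move=> b0; have := norm_maxlin_le z.
have := softmax_ge_maxlin z b0; have := softmax_le_maxlin z b0.
have c0 : 0 <= ln #|S|%:R / b by rewrite divr_ge0 ?ln_card_ge0 ?ltW.
move=> h1 h2; rewrite !ler_norml => /andP[h3 h4].
by apply/andP; split; lra.
Qed.

Local Notation RI := (g_sigma_algebraType (@cylinders R I)).

Let borel_sum (K : finType) (B : pred K) (h : K -> (I -> R) -> R) :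
  (forall k, borel (h k)) -> borel (fun z => \sum_(k | B k) h k z).
Proof.
move=> mh.
have -> : (fun z => \sum_(k | B k) h k z) =
    (fun z => \sum_k (if B k then h k z else 0)).
  by apply/funext => z; rewrite big_mkcond.
apply: (@measurable_sum _ RI R setT _ _ (fun k (z : RI) =>
  if B k then h k z else 0)) => k.
by case: (B k); [exact: mh|exact: measurable_cst].
Qed.

Lemma borel_lin j : borel (lin ^~ j).
Proof. by apply: borel_sum => i; exact: borel_coord. Qed.

Lemma borel_maxlin : borel maxlin.
Proof.
rewrite /maxlin; elim: (index_enum J) => [|j s mG].
  have -> : (fun z => \big[Num.max/lin z j0]_(j <- [::] | S j) lin z j) =
      lin ^~ j0 by apply/funext => z; rewrite big_nil.
  exact: borel_lin.
have -> : (fun z => \big[Num.max/lin z j0]_(i <- j :: s | S i) lin z i) =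
    (fun z => if S j then
      Num.max (lin z j) (\big[Num.max/lin z j0]_(i <- s | S i) lin z i)
      else \big[Num.max/lin z j0]_(i <- s | S i) lin z i).
  by apply/funext => z; rewrite big_cons.
by case: (S j) => //; exact: (measurable_maxr (borel_lin j) mG).
Qed.

Let borel_expR_lin b (B : pred J) :
  borel (fun z => \sum_(j | B j) expR (b * lin z j)).
Proof.
apply: borel_sum => j; apply: (measurableT_comp (@measurable_expR R)).
by apply: measurable_funM; [exact: measurable_cst|exact: borel_lin].
Qed.

Lemma borel_softmax b : borel (softmax b).
Proof.
apply: (measurable_funM (f := cst b^-1)); first exact: measurable_cst.
exact: (measurableT_comp (@measurable_ln R) (borel_expR_lin b S)).
Qed.

Lemma borel_gibbs b e : borel (fun z => gibbs b z e).
Proof.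
have -> : (fun z => gibbs b z e) =
    (fun z => (\sum_(j | S j && A j e) expR (b * lin z j)) *
       (partition_fun b z) `^ (-1)).
  apply/funext => z.
  by rewrite powR_inv1// ltW// partition_fun_gt0.
apply: (measurable_funM (borel_expR_lin b (fun j => S j && A j e))).
exact: (measurableT_comp (measurable_powR _) (borel_expR_lin b S)).
Qed.

End SoftMax.

(** * Integrability by exponential domination *)

Section Domination.
Context {R : realType}.
Local Notation law := (probability (measurableTypeR R) R).

Definition exp2 (x : R) : R := expR (2 * `|x|).

Lemma exp2_gt0 x : 0 < exp2 x. Proof. exact: expR_gt0. Qed.

Lemma norm_le_exp2 x : `|x| <= exp2 x.
Proof.
by have := expR_ge1Dx (2 * `|x|); have := normr_ge0 x; rewrite /exp2; lra.
Qed.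

Lemma sqr_le_exp2 x : x ^+ 2 <= exp2 x.
Proof.
rewrite -real_normK ?num_real// /exp2 expRM_natl lerXn2r ?nnegrE ?expR_ge0//.
by have := expR_ge1Dx `|x|; lra.
Qed.

Lemma measurable_exp2 : measurable_fun [set: R] exp2.
Proof.
by apply: measurableT_comp => //; apply: measurable_funM.
Qed.

Lemma integrable_le d (T : measurableType d) (P : probability T R)
    (f g : T -> R) : measurable_fun setT f -> (forall w, `|f w| <= g w) ->
  P.-integrable setT (EFin \o g) -> P.-integrable setT (EFin \o f).
Proof.
move=> mf fg; apply: le_integrable => //; first exact/measurable_EFinP.
by move=> w _ /=; rewrite lee_fin (le_trans (fg w))// ler_norm.
Qed.

Lemma integrable_cst d (T : measurableType d) (P : probability T R) (c : R) :
  P.-integrable setT (EFin \o (fun=> c)).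
Proof. exact: finite_measure_integrable_cst. Qed.

Lemma Rintegral_prob_cst d (T : measurableType d) (P : probability T R)
    (c : R) :
  \int[P]_w (cst c w) = c.
Proof.
rewrite Rintegral_cst// -[RHS]mulr1; congr (_ * _).
by rewrite -[RHS]/(fine 1%E); congr fine; exact: probability_setT.
Qed.

Lemma integrable_Rsum d (T : measurableType d) (P : probability T R)
    (I : finType) (f : I -> T -> R) :
  (forall i, P.-integrable setT (EFin \o f i)) ->
  P.-integrable setT (EFin \o (fun w => \sum_i f i w)).
Proof.
move=> fi; have -> : EFin \o (fun w => \sum_i f i w) =
    (fun w => \sum_(i <- index_enum I) (EFin \o f i) w)%E.
  by apply/funext => w /=; rewrite sumEFin.
by apply: integrable_sum => // i _; exact: fi.
Qed.

Lemma Rintegral_sum d (T : measurableType d) (P : probability T R)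
    (I : finType) (f : I -> T -> R) :
  (forall i, P.-integrable setT (EFin \o f i)) ->
  \int[P]_w (\sum_i f i w) = \sum_i \int[P]_w f i w.
Proof.
move=> fi; apply: EFin_inj; rewrite -sumEFin.
rewrite /Rintegral fineK; last first.
  by apply: integrable_fin_num => //; exact: integrable_Rsum.
under eq_integral do rewrite -sumEFin.
rewrite (integral_sum measurableT fi); apply: eq_bigr => i _.
by rewrite fineK//; apply: integrable_fin_num => //; exact: fi.
Qed.

(** A growth condition on functionals that all those of interest satisfy, and
    that makes them integrable as soon as each coordinate has a finite
    exponential moment. *)
Definition exp2_dominated (I : finType) (G : (I -> R) -> R) : Prop :=
  exists c : R, forall z, `|G z| <= c * (1 + \sum_i exp2 (z i)).

Lemma integrable_dominated d (T : measurableType d) (P : probability T R)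
    (I : finType) (X : I -> T -> R) (G : (I -> R) -> R) :
  (forall i, measurable_fun setT (X i)) ->
  (forall i, P.-integrable setT (EFin \o (exp2 \o X i))) ->
  borel G -> exp2_dominated G ->
  P.-integrable setT (EFin \o (fun w => G (fun i => X i w))).
Proof.
move=> mX iX mG [c Gc].
apply: (integrable_le (borel_comp mX mG) (fun w => Gc _)).
have iS := integrable_Rsum (f := fun i w => exp2 (X i w)) iX.
exact: (integrableZl measurableT c
  (integrableD measurableT (integrable_cst P 1) iS)).
Qed.

Lemma borel_dim1 (f : R -> R) : measurable_fun setT f ->
  borel (fun z : unit -> R => f (z tt)).
Proof. by move=> mf; exact: (measurableT_comp mf (borel_coord tt)). Qed.

Section Marginals.
Variables (d : measure_display) (T : measurableType d) (P : probability T R).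
Variables (I : finType) (X : I -> T -> R) (mu : I -> law).
Hypothesis lX : product_law P X mu.
Variables (i : I) (f : R -> R).
Hypotheses (mf : measurable_fun setT f).
Hypothesis fi : (mu i).-integrable setT (EFin \o f).

Let lXi : product_law P (fun _ : unit => X i) (fun=> mu i).
Proof.
have inj : injective (fun _ : unit => i) by move=> [] [].
exact: product_law_inj inj lX.
Qed.

Lemma marginal_integrable : P.-integrable setT (EFin \o (f \o X i)).
Proof.
exact: (same_law_integrable (product_law_single (mu i)) lXi (borel_dim1 mf)).
Qed.

Lemma marginal_Rintegral : \int[P]_w f (X i w) = \int[mu i]_x f x.
Proof.
by rewrite (same_law_Rintegral (product_law_single (mu i)) lXi (borel_dim1 mf)).
Qed.

End Marginals.

Lemma product_law_integrable d (T : measurableType d) (P : probability T R)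
    (I : finType) (X : I -> T -> R) (mu : I -> law) (G : (I -> R) -> R) :
  product_law P X mu ->
  (forall i, (mu i).-integrable setT (EFin \o exp2)) ->
  borel G -> exp2_dominated G ->
  P.-integrable setT (EFin \o (fun w => G (fun i => X i w))).
Proof.
move=> lX imu mG dG; apply: integrable_dominated => //; first exact: lX.1.
by move=> i; exact: (marginal_integrable lX measurable_exp2 (imu i)).
Qed.

Lemma upd_integrable (D : law) (I : finType) (G : (I -> R) -> R) z e :
  D.-integrable setT (EFin \o exp2) -> borel G -> exp2_dominated G ->
  D.-integrable setT (EFin \o (fun x => G (upd z e x))).
Proof.
move=> iD mG dG.
apply: (@integrable_dominated _ (measurableTypeR R) D I
  (fun i x => upd z e x i) G) => //.
  by move=> i; rewrite /upd; case: (i == e).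
move=> i; rewrite /upd; case: (i == e) => //.
exact: integrable_cst.
Qed.

Variables (I J : finType) (S : pred J) (A : J -> pred I) (j0 : J).
Hypothesis Sj0 : S j0.

Lemma dominated_softmax b : 0 < b -> exp2_dominated (softmax S A b).
Proof.
move=> b0; set c := ln #|S|%:R / b.
have c0 : 0 <= c by rewrite divr_ge0 ?(ln_card_ge0 Sj0) ?ltW.
exists (1 + c) => z; apply: le_trans (norm_softmax_le A Sj0 z b0) _.
have : \sum_i `|z i| <= \sum_i exp2 (z i).
  by apply: ler_sum => i _; exact: norm_le_exp2.
have : 0 <= \sum_i exp2 (z i) by apply: sumr_ge0 => i _; exact: expR_ge0.
by rewrite -/c; nra.
Qed.

Lemma dominated_gibbs b e : exp2_dominated (fun z => gibbs S A b z e).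
Proof.
exists 1 => z; rewrite mul1r ger0_norm ?(gibbs_ge0 A Sj0)//.
apply: le_trans (gibbs_le1 A Sj0 _ _ _) _.
by rewrite lerDl; apply: sumr_ge0 => i _; exact: expR_ge0.
Qed.

Lemma dominated_maxlin : exp2_dominated (maxlin S A j0).
Proof.
exists 1 => z; rewrite mul1r; apply: le_trans (norm_maxlin_le A Sj0 _) _.
apply: (@le_trans _ _ (\sum_i exp2 (z i))); last by rewrite lerDr.
by apply: ler_sum => i _; exact: norm_le_exp2.
Qed.

End Domination.

(** * Changing the law of one coordinate *)

Section QuadraticApproximation.
Context {R : realType}.
Variables (D : probability (measurableTypeR R) R) (M : R).
Hypothesis iexp2 : D.-integrable setT (EFin \o exp2).
Hypothesis exp2M : \int[D]_x exp2 x <= M.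

Let ix : D.-integrable setT (EFin \o (fun x : R => x)).
Proof. by apply: integrable_le iexp2 => //; exact: norm_le_exp2. Qed.

Let ix2 : D.-integrable setT (EFin \o (fun x : R => x ^+ 2)).
Proof.
apply: integrable_le iexp2 => // x.
by rewrite ger0_norm ?sqr_ge0// sqr_le_exp2.
Qed.

Lemma quadratic_Rintegral (c0 c1 c2 : R) :
  D.-integrable setT (EFin \o (fun x => c0 + c1 * x + c2 * x ^+ 2)) /\
  \int[D]_x (c0 + c1 * x + c2 * x ^+ 2) =
  c0 + c1 * \int[D]_x x + c2 * \int[D]_x (x ^+ 2).
Proof.
have i1 : D.-integrable setT (EFin \o (fun x => c1 * x)).
  exact: (integrableZl measurableT c1 ix).
have i2 : D.-integrable setT (EFin \o (fun x => c2 * x ^+ 2)).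
  exact: (integrableZl measurableT c2 ix2).
have i0 := integrable_cst D c0.
have i01 : D.-integrable setT (EFin \o (fun x => c0 + c1 * x)).
  exact: (integrableD measurableT i0 i1).
split; first exact: (integrableD measurableT i01 i2).
by rewrite RintegralD// RintegralD// RintegralZl// RintegralZl//
  Rintegral_prob_cst.
Qed.

Lemma quadratic_approx_Rintegral (f : R -> R) (c0 c1 c2 k : R) : 0 <= k ->
  D.-integrable setT (EFin \o f) ->
  (forall x, `|f x - (c0 + c1 * x + c2 * x ^+ 2)| <= k * exp2 x) ->
  `|\int[D]_x f x - (c0 + c1 * \int[D]_x x + c2 * \int[D]_x (x ^+ 2))| <=
  k * M.
Proof.
move=> k0 fi fk; have [qi <-] := quadratic_Rintegral c0 c1 c2.
rewrite -RintegralB//.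
have di : D.-integrable setT
    (EFin \o (fun x => f x - (c0 + c1 * x + c2 * x ^+ 2))).
  exact: (integrableB measurableT fi qi).
apply: le_trans (le_normr_Rintegral measurableT di) _.
apply: (@le_trans _ _ (\int[D]_x (k * exp2 x))).
  apply: le_Rintegral => //; first exact: (integrable_norm di).
  exact: (integrableZl measurableT k iexp2).
by rewrite RintegralZl// ler_wpM2l.
Qed.

End QuadraticApproximation.

Section Replacement.
Context {R : realType}.
Local Notation law := (probability (measurableTypeR R) R).
Variables (I J : finType) (S : pred J) (A : J -> pred I) (j0 : J).
Hypothesis Sj0 : S j0.

(** The mean and the second moment are those common to the two laws of the
    theorem. *)
Definition moment_class (M : R) (D : law) : Prop :=
  [/\ D.-integrable setT (EFin \o exp2), \int[D]_x exp2 x <= M,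
      \int[D]_x x = 1 / 2 & \int[D]_x (x ^+ 2) = 1 / 2].

Variables (M b : R).
Hypothesis b01 : 0 < b <= 1.

Section OneLaw.
Variables (D : law).
Hypothesis DM : moment_class M D.

Lemma softmax_coordinate_Rintegral z e :
  `|\int[D]_x softmax S A b (upd z e x) -
    (softmax S A b (upd z e 0) + gibbs S A b (upd z e 0) e * (1 / 2) +
     b * (gibbs S A b (upd z e 0) e * (1 - gibbs S A b (upd z e 0) e)) / 2 *
       (1 / 2))|
  <= 27 * b ^+ 2 * gibbs S A b (upd z e 0) e * M.
Proof.
have /andP[b0 b1] := b01.
set p := gibbs _ _ _ _ _.
have p01 : 0 <= p <= 1 by rewrite (gibbs_ge0 A Sj0) (gibbs_le1 A Sj0).
have [iexp2 eM m1 m2] := DM.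
have := @quadratic_approx_Rintegral _ D M iexp2 eM
  (fun x => softmax S A b (upd z e x)) (softmax S A b (upd z e 0)) p
  (b * (p * (1 - p)) / 2) (27 * b ^+ 2 * p).
rewrite m1 m2; apply.
- apply: mulr_ge0; last exact: (gibbs_ge0 A Sj0).
  by apply: mulr_ge0; [exact: ler0n|exact: sqr_ge0].
- apply: upd_integrable => //; first exact: borel_softmax.
  exact: (dominated_softmax A Sj0 b0).
- move=> x; rewrite (softmax_upd A Sj0) -/p.
  apply: le_trans (scaled_softplus_taylor x p01 b01).
  by apply: le_of_eq; congr `| _ |; ring.
Qed.

(** Bounds a Gibbs probability with the weight of [e] put to 0, as it appears
    in the Taylor remainder, by its expectation when this weight is random. *)
Lemma gibbs_coordinate_Rintegral z e :
  gibbs S A b (upd z e 0) e / 4 <= \int[D]_x gibbs S A b (upd z e x) e.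
Proof.
set p := gibbs _ _ _ _ _.
have p01 : 0 <= p <= 1 by rewrite (gibbs_ge0 A Sj0) (gibbs_le1 A Sj0).
have [iexp2 _ m1 m2] := DM.
have [qi qE] := quadratic_Rintegral iexp2 (p / 2) 0 (- p / 2).
have -> : p / 4 = p / 2 + 0 * \int[D]_x x + (- p / 2) * \int[D]_x (x ^+ 2).
  by rewrite m2; field.
rewrite -qE; apply: le_Rintegral => //.
  exact: (upd_integrable (G := fun z => gibbs S A b z e) z e iexp2
    (borel_gibbs A Sj0 b e) (dominated_gibbs A Sj0 b e)).
move=> x _; rewrite (gibbs_upd A Sj0) -/p.
apply: le_trans (tilt_ge_quadratic x p01 b01).
by apply: le_of_eq; ring.
Qed.

End OneLaw.

(** Both integrals have the same second-order expansion, since the moments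
    agree. The remainders are proportional to the Gibbs probability at weight
    0, which is at most 4 times its mean under either law; the minimum leaves
    the choice of the law to the averaging over sets. *)
Lemma softmax_coordinate_compare (D N : law) z e :
  moment_class M D -> moment_class M N ->
  `|\int[D]_x softmax S A b (upd z e x) -
    \int[N]_x softmax S A b (upd z e x)| <=
  216 * b ^+ 2 * M * Num.min (\int[N]_x gibbs S A b (upd z e x) e)
    (\int[D]_x gibbs S A b (upd z e x) e).
Proof.
move=> DM NM.
have M0 : 0 <= M.
  have [_ eM _ _] := DM; apply: le_trans eM; apply: Rintegral_ge0 => x _.
  exact: expR_ge0.
have := softmax_coordinate_Rintegral DM z e.
have := softmax_coordinate_Rintegral NM z e.
have := gibbs_coordinate_Rintegral DM z e.
have := gibbs_coordinate_Rintegral NM z e.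
set p := gibbs _ _ _ _ _ => gN gD sN sD.
have gmin : p / 4 <= Num.min (\int[N]_x gibbs S A b (upd z e x) e)
    (\int[D]_x gibbs S A b (upd z e x) e) by rewrite le_min gN gD.
set g := Num.min _ _ in gmin *.
have k0 : 0 <= 216 * b ^+ 2 * M.
  apply: mulr_ge0; last exact: M0.
  by apply: mulr_ge0; [exact: ler0n|exact: sqr_ge0].
apply: le_trans (ler_wpM2l k0 gmin).
have -> : 216 * b ^+ 2 * M * (p / 4) =
    27 * b ^+ 2 * p * M + 27 * b ^+ 2 * p * M by field.
rewrite -(subrKA (softmax S A b (upd z e 0) + p * (1 / 2) +
  b * (p * (1 - p)) / 2 * (1 / 2))).
by apply: le_trans (ler_normD _ _) _; rewrite [X in _ + X]distrC lerD.
Qed.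

End Replacement.

(** * The replacement method *)

Section Hybrids.
Context {R : realType}.
Local Notation law := (probability (measurableTypeR R) R).
Variable I : finType.
Variables (d1 d2 : measure_display).
Variables (T1 : measurableType d1) (T2 : measurableType d2).
Variables (P1 : probability T1 R) (P2 : probability T2 R).
Variables (X : I -> T1 -> R) (Y : I -> T2 -> R).

Definition hybrid (B : {set I}) (i : I) (w : T1 * T2) : R :=
  if i \in B then X i w.1 else Y i w.2.

Definition hybrid_law (D N : law) (B : {set I}) (i : I) : law :=
  if i \in B then D else N.

Lemma product_law_hybrid (D N : law) B :
  product_law P1 X (fun=> D) -> product_law P2 Y (fun=> N) ->
  product_law (P1 \x P2)%E (hybrid B) (hybrid_law D N B).
Proof.
move=> lX lY; pose tau i : I + I := if i \in B then inl i else inr i.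
have tau_inj : injective tau.
  by move=> i j; rewrite /tau; do 2!case: ifP => _; case.
apply: eq_product_law (product_law_inj tau_inj (product_law_pair lX lY)).
- by move=> i w; rewrite /tau /hybrid; case: ifP.
- by move=> i; rewrite /tau /hybrid_law; case: ifP.
Qed.

Lemma upd_hybrid (B : {set I}) (e : I) x w : e \notin B ->
  upd (fun i => hybrid (e |: B)%SET i w) e x =
  upd (fun i => hybrid B i w) e x.
Proof.
move=> eB; apply/funext => i; rewrite /upd /hybrid !inE.
by case: (i =P e).
Qed.

End Hybrids.

Section Lindeberg.
Context {R : realType}.
Local Notation law := (probability (measurableTypeR R) R).
Variables (I J : finType) (S : pred J) (A : J -> pred I) (j0 : J).
Hypothesis Sj0 : S j0.
Variables (m : nat) (M : R).
Hypothesis Am : forall j, S j -> (#|A j| <= m)%N.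
Variables (d1 d2 : measure_display).
Variables (T1 : measurableType d1) (T2 : measurableType d2).
Variables (P1 : probability T1 R) (P2 : probability T2 R).
Variables (X : I -> T1 -> R) (Y : I -> T2 -> R) (D N : law).
Hypotheses (lX : product_law P1 X (fun=> D)) (lY : product_law P2 Y (fun=> N)).
Hypotheses (DM : moment_class M D) (NM : moment_class M N).

Local Notation Q := (P1 \x P2)%E.
Let H (B : {set I}) (w : T1 * T2) : I -> R := fun i => hybrid X Y B i w.
Let lH B : product_law Q (hybrid X Y B) (hybrid_law D N B).
Proof. exact: product_law_hybrid. Qed.

Let iexp B (i : I) : (hybrid_law D N B i).-integrable setT (EFin \o exp2).
Proof.
by rewrite /hybrid_law; case: ifP => _; [case: DM|case: NM].
Qed.

Let iH B (G : (I -> R) -> R) : borel G -> exp2_dominated G ->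
  Q.-integrable setT (EFin \o (fun w => G (H B w))).
Proof. exact: product_law_integrable (lH B) (iexp B). Qed.

Let decoupleH (G : (I -> R) -> R) B e : borel G -> exp2_dominated G ->
  Q.-integrable setT (EFin \o
    (fun w => \int[hybrid_law D N B e]_x G (upd (H B w) e x))) /\
  \int[Q]_w G (H B w) =
  \int[Q]_w \int[hybrid_law D N B e]_x G (upd (H B w) e x).
Proof.
move=> mG dG; have iz z := upd_integrable z e (iexp B e) mG dG.
exact: (decoupling (lH B) mG (iH B mG dG) iz).
Qed.

(** The hybrid family over B takes the coordinates in B from X and the others
    from Y. Adding [e] to B changes the law of coordinate [e] only, and the
    change of the expectation is at most a multiple of the mean Gibbs
    probability of [e] for either of the two hybrids; the averaging lemma
    concludes. *)
Lemma softmax_compare b : 0 < b <= 1 ->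
  `|\int[P1]_w softmax S A b (X ^~ w) - \int[P2]_w softmax S A b (Y ^~ w)| <=
  432 * b ^+ 2 * M * m%:R.
Proof.
move=> b01; have /andP[b0 b1] := b01.
have M0 : 0 <= M.
  have [_ eM _ _] := DM; apply: le_trans eM; apply: Rintegral_ge0 => x _.
  exact: expR_ge0.
set c := 216 * b ^+ 2 * M.
have c0 : 0 <= c.
  apply: mulr_ge0; last exact: M0.
  by apply: mulr_ge0; [exact: ler0n|exact: sqr_ge0].
have mS := borel_softmax S A b.
have dS := dominated_softmax A Sj0 b0.
have mg e := borel_gibbs A Sj0 b e.
have dg e := dominated_gibbs A Sj0 b e.
pose h B := \int[Q]_w softmax S A b (H B w).
pose q e B := c * \int[Q]_w gibbs S A b (H B w) e.
have q0 e B : 0 <= q e B.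
  apply: mulr_ge0 => //; apply: Rintegral_ge0 => w _.
  exact: (gibbs_ge0 A Sj0).
have hq (e : I) (B : {set I}) : e \notin B ->
    `|h (e |: B)%SET - h B| <= Num.min (q e B) (q e (e |: B)%SET).
  move=> eB.
  have lawB : hybrid_law D N B e = N by rewrite /hybrid_law (negbTE eB).
  have laweB : hybrid_law D N (e |: B) e = D.
    by rewrite /hybrid_law finset.setU11.
  have updE w x : upd (H (e |: B)%SET w) e x = upd (H B w) e x.
    exact: upd_hybrid.
  have [is1 es1] := decoupleH (e |: B)%SET e mS dS.
  have [is0 es0] := decoupleH B e mS dS.
  have [ig1 eg1] := decoupleH (e |: B)%SET e (mg e) (dg e).
  have [ig0 eg0] := decoupleH B e (mg e) (dg e).
  rewrite lawB in is0 es0 ig0 eg0; rewrite laweB in is1 es1 ig1 eg1.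
  have idiff := integrableB measurableT is1 is0.
  have le_gen (g : T1 * T2 -> R) :
      Q.-integrable setT (EFin \o g) ->
      (forall w, `|\int[D]_x softmax S A b (upd (H (e |: B)%SET w) e x) -
         \int[N]_x softmax S A b (upd (H B w) e x)| <= c * g w) ->
      `|h (e |: B)%SET - h B| <= c * \int[Q]_w g w.
    move=> ig le; rewrite /h es1 es0 -RintegralB//.
    apply: le_trans (le_normr_Rintegral measurableT idiff) _.
    rewrite -RintegralZl//; apply: le_Rintegral => //.
      exact: (integrable_norm idiff).
    exact: (integrableZl measurableT c ig).
  have cmp w : `|\int[D]_x softmax S A b (upd (H (e |: B)%SET w) e x) -
       \int[N]_x softmax S A b (upd (H B w) e x)| <=
      c * Num.min (\int[N]_x gibbs S A b (upd (H B w) e x) e)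
          (\int[D]_x gibbs S A b (upd (H (e |: B)%SET w) e x) e).
    under eq_Rintegral do rewrite updE.
    under [X in _ <= _ * Num.min _ X]eq_Rintegral do rewrite updE.
    exact: (softmax_coordinate_compare A Sj0 b01 (H B w) e DM NM).
  rewrite le_min; apply/andP; split.
    rewrite /q eg0; apply: le_gen => // w.
    by apply: le_trans (cmp w) _; rewrite ler_wpM2l// ge_min lexx.
  rewrite /q eg1; apply: le_gen => // w.
  by apply: le_trans (cmp w) _; rewrite ler_wpM2l// ge_min lexx orbT.
have qm B : \sum_e q e B <= c * m%:R.
  have ie e := iH B (mg e) (dg e).
  rewrite -mulr_sumr ler_wpM2l// -(Rintegral_sum ie).
  rewrite -[leRHS](@Rintegral_prob_cst _ _ _ Q); apply: le_Rintegral => //.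
  - exact: (integrable_Rsum ie).
  - exact: integrable_cst.
  - by move=> w _; exact: (sum_gibbs_le Sj0).
have := set_average_bound q0 hq qm.
have -> : h [set: I]%SET = \int[P1]_w softmax S A b (X ^~ w).
  have lT : product_law Q (hybrid X Y [set: I]%SET) (fun=> D).
    apply: eq_product_law (lH [set: I]%SET) => // i.
    by rewrite /hybrid_law finset.inE.
  exact: (same_law_Rintegral lT lX mS (iH _ mS dS)).
have -> : h finset.set0 = \int[P2]_w softmax S A b (Y ^~ w).
  have lT : product_law Q (hybrid X Y finset.set0) (fun=> N).
    apply: eq_product_law (lH finset.set0) => // i.
    by rewrite /hybrid_law finset.inE.
  exact: (same_law_Rintegral lT lY mS (iH _ mS dS)).
by rewrite /c (_ : 2 * _ = 432 * b ^+ 2 * M * m%:R); last by ring.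
Qed.

End Lindeberg.

Section MaxCompare.
Context {R : realType}.
Local Notation law := (probability (measurableTypeR R) R).
Variables (I J : finType) (S : pred J) (A : J -> pred I) (j0 : J).
Hypothesis Sj0 : S j0.

Lemma maxlin_integrable d (T : measurableType d) (P : probability T R)
    (X : I -> T -> R) (D : law) M :
  product_law P X (fun=> D) -> moment_class M D ->
  P.-integrable setT (EFin \o (fun w => maxlin S A j0 (X ^~ w))).
Proof.
move=> lX [iD _ _ _]; apply: (product_law_integrable lX) => //.
  exact: borel_maxlin.
exact: dominated_maxlin.
Qed.

(** The two error terms, the gap between maximum and soft maximum and the
    replacement error, are balanced by the choice of [b]. *)
Lemma maxlin_compare (m : nat) (M b : R) d1 d2 (T1 : measurableType d1)
    (T2 : measurableType d2) (P1 : probability T1 R) (P2 : probability T2 R)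
    (X : I -> T1 -> R) (Y : I -> T2 -> R) (D N : law) :
  (forall j, S j -> (#|A j| <= m)%N) ->
  product_law P1 X (fun=> D) -> product_law P2 Y (fun=> N) ->
  moment_class M D -> moment_class M N -> 0 < b <= 1 ->
  `|\int[P1]_w maxlin S A j0 (X ^~ w) - \int[P2]_w maxlin S A j0 (Y ^~ w)| <=
  ln #|S|%:R / b + 432 * b ^+ 2 * M * m%:R.
Proof.
move=> Am lX lY DM NM b01; have /andP[b0 _] := b01.
have bounds d (T : measurableType d) (P : probability T R) (Z : I -> T -> R)
    (E : law) : product_law P Z (fun=> E) -> moment_class M E ->
    \int[P]_w maxlin S A j0 (Z ^~ w) <= \int[P]_w softmax S A b (Z ^~ w) <=
    \int[P]_w maxlin S A j0 (Z ^~ w) + ln #|S|%:R / b.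
  move=> lZ EM; have im := maxlin_integrable lZ EM.
  have is_ : P.-integrable setT (EFin \o (fun w => softmax S A b (Z ^~ w))).
    apply: (product_law_integrable lZ); first by case: EM.
      exact: borel_softmax.
    exact: (dominated_softmax A Sj0 b0).
  apply/andP; split.
    by apply: le_Rintegral => // w _; exact: (softmax_ge_maxlin _ Sj0).
  rewrite -[X in _ + X](Rintegral_prob_cst P) -RintegralD//; last first.
    exact: integrable_cst.
  apply: le_Rintegral => //.
    exact: (integrableD measurableT im (integrable_cst P _)).
  by move=> w _; exact: (softmax_le_maxlin _ Sj0).
have /andP[x1 x2] := bounds _ _ _ _ _ lX DM.
have /andP[y1 y2] := bounds _ _ _ _ _ lY NM.
have := softmax_compare Sj0 Am lX lY DM NM b01.
by rewrite !ler_norml => /andP[u1 u2]; apply/andP; split; lra.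
Qed.

End MaxCompare.

(** * The Efron-Stein inequality *)

Section EfronStein.
Context {R : realType}.
Local Notation law := (probability (measurableTypeR R) R).
Variables (I : finType) (d : measure_display) (T : measurableType d).
Variables (P : probability T R) (X : I -> T -> R) (D : law).
Hypothesis lX : product_law P X (fun=> D).
Hypothesis iD : D.-integrable setT (EFin \o exp2).

(** A vector indexed by [I + I] holds a family and an independent copy of it;
    the selection takes the coordinates in [B] from the family and the others
    from the copy. *)
Definition select (B : {set I}) (v : I + I -> R) (i : I) : R :=
  if i \in B then v (inl i) else v (inr i).

Definition swap (C : {set I}) (k : I + I) : I + I :=
  match k with
  | inl i => if i \in C then inr i else inl i
  | inr i => if i \in C then inl i else inr i
  end.

Lemma select_swap (B C : {set I}) v :
  select B (v \o swap C) = select [set i | (i \in B) (+) (i \in C)]%SET v.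
Proof.
apply/funext => i; rewrite /select /swap finset.inE /=.
by case: (i \in B); case: (i \in C).
Qed.

Local Notation Q := (P \x P)%E.
Let V (w : T * T) : I + I -> R := fun k => pair_family X X k w.

Let lV : product_law Q (pair_family X X) (fun=> D).
Proof.
have := product_law_pair lX lX.
by apply: eq_product_law => // -[].
Qed.

Let iV (G : (I + I -> R) -> R) : borel G -> exp2_dominated G ->
  Q.-integrable setT (EFin \o (fun w => G (V w))).
Proof. exact: (product_law_integrable lV (fun=> iD)). Qed.

Lemma swap_inj C : injective (swap C).
Proof.
apply: (can_inj (g := swap C)).
by case=> i; rewrite /swap; case: ifP => /= ->.
Qed.

(** Exchanging some coordinates with their copies relabels an i.i.d. family. *)
Lemma swap_Rintegral (C : {set I}) (G : (I + I -> R) -> R) :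
  borel G -> exp2_dominated G ->
  \int[Q]_w G (V w) = \int[Q]_w G (V w \o swap C).
Proof.
move=> mG dG; have lS := product_law_inj (@swap_inj C) lV.
exact: (same_law_Rintegral lV lS mG (iV mG dG)).
Qed.

Variable F : (I -> R) -> R.
Hypotheses (mF : borel F) (dF2 : exp2_dominated (fun z => F z ^+ 2)).

Lemma borel_select B : borel (fun v => F (select B v)).
Proof.
apply: (borel_comp (T := g_sigma_algebraType (@cylinders R (I + I)%type))
  (X := fun i v => select B v i) _ mF) => i.
by rewrite /select; case: (i \in B); exact: borel_coord.
Qed.

Lemma dominated_select_sqr B : exp2_dominated (fun v => F (select B v) ^+ 2).
Proof.
have [c Fc] := dF2.
exists `|c| => v; apply: le_trans (Fc _) _.
have le1 : 1 + \sum_i exp2 (select B v i) <= 1 + \sum_k exp2 (v k).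
  rewrite lerD2l big_sumType/= -big_split/=; apply: ler_sum => i _.
  by rewrite /select; case: ifP => _; rewrite ?lerDl ?lerDr ltW ?exp2_gt0.
have s0 : 0 <= 1 + \sum_i exp2 (select B v i).
  by rewrite addr_ge0 ?sumr_ge0// => i _; rewrite ltW ?exp2_gt0.
apply: (@le_trans _ _ (`|c| * (1 + \sum_i exp2 (select B v i)))).
  by rewrite ler_wpM2r// ler_norm.
by rewrite ler_wpM2l.
Qed.

Lemma exp2_dominated_le (K : finType) (G H1 H2 : (K -> R) -> R) (a : R) :
  0 <= a -> exp2_dominated H1 -> exp2_dominated H2 ->
  (forall z, `|G z| <= a * (H1 z + H2 z)) -> exp2_dominated G.
Proof.
move=> a0 [c1 h1] [c2 h2] GH; exists (a * (c1 + c2)) => z.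
apply: le_trans (GH z) _; rewrite -mulrA ler_wpM2l// mulrDl.
by apply: lerD; apply: le_trans (ler_norm _) _.
Qed.

Let Fs B v := F (select B v).

Lemma borel_selectM B C : borel (fun v => Fs B v * Fs C v).
Proof. by apply: measurable_funM; exact: borel_select. Qed.

Lemma dominated_selectM B C : exp2_dominated (fun v => Fs B v * Fs C v).
Proof.
apply: (exp2_dominated_le (a := 1) _ (dominated_select_sqr B)
  (dominated_select_sqr C)) => // v; rewrite mul1r normrM.
rewrite -(real_normK (num_real (Fs B v))) -(real_normK (num_real (Fs C v))).
by have := sqr_ge0 (`|Fs B v| - `|Fs C v|); nra.
Qed.

(** The positive part is kept because only losses of a maximum are easy to
    bound. *)
Let posdiff B C v : R := Num.max 0 (Fs B v - Fs C v) ^+ 2.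

Lemma borel_posdiff B C : borel (posdiff B C).
Proof.
apply: measurable_funX; apply: measurable_maxr; first exact: measurable_cst.
by apply: measurable_funB; exact: borel_select.
Qed.

Lemma posdiff_le B C v : posdiff B C v <= 2 * (Fs B v ^+ 2 + Fs C v ^+ 2).
Proof.
rewrite /posdiff; have := sqr_ge0 (Fs B v + Fs C v).
have := sqr_ge0 (Fs B v); have := sqr_ge0 (Fs C v).
by rewrite /Num.max; case: ifP => _; nra.
Qed.

Lemma dominated_posdiff B C : exp2_dominated (posdiff B C).
Proof.
apply: (exp2_dominated_le (a := 2) _ (dominated_select_sqr B)
  (dominated_select_sqr C)) => // v.
by rewrite ger0_norm ?sqr_ge0// posdiff_le.
Qed.

Let v_ e := \int[Q]_w posdiff [set: I]%SET [set~ e]%SET (V w).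

Let h B := \int[Q]_w (Fs [set: I]%SET (V w) * Fs B (V w)).

Let symd (B C : {set I}) : {set I} := [set i | (i \in B) (+) (i \in C)]%SET.

Let Fs_swap B C v : Fs B (v \o swap C) = Fs (symd B C) v.
Proof. by rewrite /Fs select_swap. Qed.

(** Put f B for the functional at the selection of B, and T, Te for the full
    set and the complement of e. Swapping coordinate e exchanges T with Te and
    e |: B with B, so that twice the left-hand side is the mean of (f T - f Te)
    (f (e |: B) - f B). By the inequality 2 x y <= x ^ 2 + y ^ 2 it is at most
    half the sum of the means of (f T - f Te) ^ 2 and (f (e |: B) - f B) ^ 2.
    Swapping the coordinates outside e |: B shows that the two are equal, and
    swapping e that the positive and the negative part of f T - f Te have the
    same second moment. *)
Lemma covariance_step (e : I) (B : {set I}) : e \notin B ->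
  h (e |: B)%SET - h B <= v_ e.
Proof.
move=> eB.
have iM B1 C1 := iV (borel_selectM B1 C1) (dominated_selectM B1 C1).
have iD2 B1 C1 := iV (borel_posdiff B1 C1) (dominated_posdiff B1 C1).
have swM B1 C1 E : \int[Q]_w (Fs B1 (V w) * Fs C1 (V w)) =
    \int[Q]_w (Fs (symd B1 E) (V w) * Fs (symd C1 E) (V w)).
  rewrite (swap_Rintegral E (borel_selectM B1 C1) (dominated_selectM B1 C1)).
  by apply: eq_Rintegral => w _; rewrite !Fs_swap.
have swD B1 C1 E : \int[Q]_w posdiff B1 C1 (V w) =
    \int[Q]_w posdiff (symd B1 E) (symd C1 E) (V w).
  rewrite (swap_Rintegral E (borel_posdiff B1 C1) (dominated_posdiff B1 C1)).
  by apply: eq_Rintegral => w _; rewrite /posdiff !Fs_swap.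
set T1 := [set: I]%SET; set Te := [set~ e]%SET; set eB' := (e |: B)%SET.
have T1e : symd T1 [set e]%SET = Te.
  by apply/setP => i; rewrite !finset.inE; case: eqP.
have Tee : symd Te [set e]%SET = T1.
  by apply/setP => i; rewrite !finset.inE; case: eqP.
have eBe : symd eB' [set e]%SET = B.
  apply/setP => i; rewrite !finset.inE; case: (i =P e) => [->|_].
    by rewrite (negbTE eB).
  by rewrite addbF.
have Be : symd B [set e]%SET = eB'.
  apply/setP => i; rewrite !finset.inE; case: (i =P e) => [->|_].
    by rewrite (negbTE eB).
  by rewrite addbF.
have eBc : symd eB' (~: eB')%SET = T1.
  by apply/setP => i; rewrite !finset.inE; case: (i == e); case: (i \in B).
have Bc : symd B (~: eB')%SET = Te.
  apply/setP => i; rewrite !finset.inE; case: (i =P e) => [->|_] /=.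
    by rewrite (negbTE eB).
  by case: (i \in B).
have E1 : \int[Q]_w (Fs T1 (V w) * Fs eB' (V w)) =
    \int[Q]_w (Fs Te (V w) * Fs B (V w)).
  by rewrite (swM _ _ [set e]%SET) T1e eBe.
have E2 : \int[Q]_w (Fs T1 (V w) * Fs B (V w)) =
    \int[Q]_w (Fs Te (V w) * Fs eB' (V w)).
  by rewrite (swM _ _ [set e]%SET) T1e Be.
have D1 : \int[Q]_w posdiff Te T1 (V w) = v_ e.
  by rewrite (swD _ _ [set e]%SET) T1e Tee.
have D2 : \int[Q]_w posdiff eB' B (V w) = v_ e.
  by rewrite (swD _ _ (~: eB')%SET) eBc Bc.
have D3 : \int[Q]_w posdiff B eB' (V w) = v_ e.
  by rewrite (swD _ _ (~: eB')%SET) eBc Bc.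
(* x y <= (x ^ 2 + y ^ 2) / 2 for the two differences, with each square split
   into the squares of its positive parts. *)
have ptw v : Fs T1 v * Fs eB' v + Fs Te v * Fs B v <=
    Fs T1 v * Fs B v + Fs Te v * Fs eB' v +
    2^-1 * (posdiff T1 Te v + posdiff Te T1 v +
      (posdiff eB' B v + posdiff B eB' v)).
  have pos (x y : R) :
      Num.max 0 (x - y) ^+ 2 + Num.max 0 (y - x) ^+ 2 = (x - y) ^+ 2.
    have [xy|/ltW xy] := leP x y.
      rewrite max_l ?subr_le0// max_r ?subr_ge0//; ring.
    rewrite max_r ?subr_ge0// max_l ?subr_le0//; ring.
  rewrite /posdiff !pos.
  by have := sqr_ge0 (Fs T1 v - Fs Te v - (Fs eB' v - Fs B v)); nra.
have iMM B1 C1 B2 C2 : Q.-integrable setT (EFin \o (fun w =>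
    Fs B1 (V w) * Fs C1 (V w) + Fs B2 (V w) * Fs C2 (V w))).
  exact: (integrableD measurableT (iM B1 C1) (iM B2 C2)).
have iDD B1 C1 B2 C2 : Q.-integrable setT (EFin \o (fun w =>
    posdiff B1 C1 (V w) + posdiff B2 C2 (V w))).
  exact: (integrableD measurableT (iD2 B1 C1) (iD2 B2 C2)).
have iDDDD : Q.-integrable setT (EFin \o (fun w =>
    posdiff T1 Te (V w) + posdiff Te T1 (V w) +
      (posdiff eB' B (V w) + posdiff B eB' (V w)))).
  exact: (integrableD measurableT (iDD _ _ _ _) (iDD _ _ _ _)).
have iDDDD2 := integrableZl measurableT 2^-1 iDDDD.
have := le_Rintegral measurableT (iMM T1 eB' Te B)
  (integrableD measurableT (iMM T1 B Te eB') iDDDD2) (fun w _ => ptw (V w)).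
rewrite RintegralD// RintegralD// RintegralD// RintegralZl// RintegralD//.
rewrite RintegralD// RintegralD// -E1 -E2 D1 D2 D3.
by rewrite /h -/T1 -/(v_ e); set v := v_ e; lra.
Qed.

Let select_V w : select [set: I]%SET (V w) = X ^~ w.1.
Proof. by apply/funext => i; rewrite /select finset.inE. Qed.

Let select_Ve w e : select [set~ e]%SET (V w) = upd (X ^~ w.1) e (X e w.2).
Proof.
by apply/funext => i; rewrite /select /upd !finset.inE; case: (i =P e) => [->|].
Qed.

Lemma integrable_sqr : P.-integrable setT (EFin \o (fun w => F (X ^~ w) ^+ 2)).
Proof.
have mF2 : borel (fun z => F z ^+ 2) by exact: measurable_funX.
exact: (product_law_integrable lX (fun=> iD) mF2 dF2).
Qed.

Lemma integrable_of_sqr : P.-integrable setT (EFin \o (fun w => F (X ^~ w))).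
Proof.
apply: integrable_le (integrableD measurableT (integrable_cst P 1)
  integrable_sqr); first exact: borel_comp lX.1 mF.
move=> w /=; rewrite -(real_normK (num_real (F _))).
by have := sqr_ge0 (`|F (X ^~ w)| - 1); nra.
Qed.

Lemma integrable_resample e : Q.-integrable setT (EFin \o (fun w =>
    Num.max 0 (F (X ^~ w.1) - F (upd (X ^~ w.1) e (X e w.2))) ^+ 2)).
Proof.
have := iV (borel_posdiff [set: I]%SET [set~ e]%SET) (dominated_posdiff _ _).
apply: eq_integrable => // w _ /=.
by rewrite /posdiff /Fs select_V select_Ve.
Qed.

(** The variance is the covariance of the functional with itself minus its
    covariance with an independent copy; the copy is turned into the original
    coordinate by coordinate. *)
Lemma efron_stein :
  \int[P]_w (F (X ^~ w) ^+ 2) - (\int[P]_w F (X ^~ w)) ^+ 2 <=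
  \sum_e \int[Q]_w
    (Num.max 0 (F (X ^~ w.1) - F (upd (X ^~ w.1) e (X e w.2))) ^+ 2).
Proof.
have chain n (B : {set I}) : #|B| = n ->
    h B - h finset.set0 <= \sum_(e in B) v_ e.
  elim: n B => [|n IH] B Bn.
    by rewrite (cards0_eq Bn) subrr big_set0.
  have /card_gt0P[e eB] : (0 < #|B|)%N by rewrite Bn.
  rewrite (big_setD1 e)//= -(subrKA (h (B :\ e)%SET)); apply: lerD.
    rewrite -{1}(finset.setD1K eB); apply: covariance_step.
    by rewrite !finset.inE eqxx.
  by apply: IH; move: Bn; rewrite (cardsD1 e) eB add1n => -[].
have hT : h [set: I]%SET = \int[P]_w (F (X ^~ w) ^+ 2).
  have lfst := product_law_fst lX lX.
  have mF2 : borel (fun z => F z ^+ 2) by exact: measurable_funX.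
  rewrite (same_law_Rintegral lX lfst mF2 integrable_sqr).
  by apply: eq_Rintegral => w _; rewrite /Fs select_V.
have h0 : h finset.set0 = (\int[P]_w F (X ^~ w)) ^+ 2.
  have iprod : Q.-integrable setT
      (EFin \o (fun w => F (X ^~ w.1) * F (X ^~ w.2))).
    have := iV (borel_selectM [set: I]%SET finset.set0)
      (dominated_selectM [set: I]%SET finset.set0).
    apply: eq_integrable => // w _ /=; rewrite /Fs select_V.
    by congr (_ * F _)%:E; apply/funext => i; rewrite /select finset.inE.
  have -> : h finset.set0 = \int[Q]_w (F (X ^~ w.1) * F (X ^~ w.2)).
    apply: eq_Rintegral => w _; rewrite /Fs select_V.
    by congr (_ * F _); apply/funext => i; rewrite /select finset.inE.
  have inner w : (\int[P]_u (F (X ^~ w) * F (X ^~ u))%:E =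
      (F (X ^~ w) * \int[P]_u F (X ^~ u))%:E)%E.
    rewrite EFinM fineK; last first.
      by apply: integrable_fin_num => //; exact: integrable_of_sqr.
    by rewrite -integralZl//; exact: integrable_of_sqr.
  rewrite expr2 -RintegralZr//; last exact: integrable_of_sqr.
  rewrite [LHS]/Rintegral -(integral12_prod_meas1 iprod); congr fine.
  by apply: eq_integral => w _; exact: inner.
have := chain _ [set: I]%SET erefl; rewrite hT h0.
move=> /le_trans; apply.
under eq_bigl do rewrite finset.inE.
apply: ler_sum => e _; apply: le_of_eq.
by apply: eq_Rintegral => w _; rewrite /posdiff /Fs select_V select_Ve.
Qed.

End EfronStein.

(** * Variance of the maximum *)

Section MaxVariance.
Context {R : realType}.
Local Notation law := (probability (measurableTypeR R) R).
Variables (I J : finType) (S : pred J) (A : J -> pred I) (j0 : J).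
Hypothesis Sj0 : S j0.
Variable m : nat.
Hypothesis Am : forall j, S j -> (#|A j| <= m)%N.

Local Notation F := (maxlin S A j0).

Lemma dominated_maxlin_sqr : exp2_dominated (fun z : I -> R => F z ^+ 2).
Proof.
exists #|I|%:R => z; rewrite ger0_norm ?sqr_ge0//.
have nF := norm_maxlin_le A Sj0 z.
rewrite -real_normK ?num_real//.
apply: (@le_trans _ _ ((\sum_i `|z i|) ^+ 2)).
  by rewrite lerXn2r ?nnegrE ?sumr_ge0.
apply: (@le_trans _ _ (\sum_i \sum_k (`|z i| ^+ 2 + `|z k| ^+ 2) / 2)).
  rewrite expr2 mulr_suml; apply: ler_sum => i _.
  rewrite mulr_sumr; apply: ler_sum => k _.
  by have := sqr_ge0 (`|z i| - `|z k|); nra.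
have Nc (x : R) : \sum_(k : I) x = #|I|%:R * x by rewrite sumr_const mulr_natl.
set s2 := \sum_i `|z i| ^+ 2.
have inner i : \sum_k (`|z i| ^+ 2 + `|z k| ^+ 2) / 2 =
    (#|I|%:R * `|z i| ^+ 2 + s2) / 2.
  by rewrite -mulr_suml big_split/= Nc.
rewrite (eq_bigr _ (fun i _ => inner i)) -mulr_suml big_split/= Nc -mulr_sumr.
rewrite -/s2 (_ : _ / 2 = #|I|%:R * s2); last by field.
rewrite ler_wpM2l// -[leLHS]add0r lerD//; apply: ler_sum => i _.
by rewrite real_normK ?num_real// sqr_le_exp2.
Qed.

(** Beyond the level [L] the factor exp (|x| - L) is at least 1, and x ^ 2 <= 4
    exp |x|. *)
Lemma sqr_le_truncated (L x : R) : 0 <= L ->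
  x ^+ 2 <= L ^+ 2 + 4 * expR (- L) * exp2 x.
Proof.
move=> L0; rewrite -real_normK ?num_real//.
have e0 : 0 <= 4 * expR (- L) * exp2 x.
  by rewrite mulr_ge0 ?mulr_ge0 ?expR_ge0.
have [xL|Lx] := leP `|x| L.
  by rewrite -[leLHS]addr0 lerD// lerXn2r ?nnegrE.
have -> : exp2 x = expR `|x| * expR `|x|.
  by rewrite -expRD /exp2; congr expR; ring.
have h1 : `|x| ^+ 2 <= 4 * expR `|x|.
  have -> : expR `|x| = expR (`|x| / 2) ^+ 2.
    by rewrite -expRM_natl; congr expR; field.
  have -> : `|x| ^+ 2 = 4 * (`|x| / 2) ^+ 2 by field.
  rewrite ler_wpM2l// lerXn2r ?nnegrE ?expR_ge0 ?divr_ge0//.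
  by have := expR_ge1Dx (`|x| / 2); lra.
have h2 : 1 <= expR (- L) * expR `|x|.
  by rewrite -expRD -expR0 ler_expR; lra.
apply: (@le_trans _ _ (4 * expR `|x| * (expR (- L) * expR `|x|))).
  by apply: le_trans h1 _; rewrite ler_peMr ?mulr_ge0 ?expR_ge0.
rewrite -[leLHS]add0r; apply: lerD; first exact: sqr_ge0.
by apply: le_of_eq; ring.
Qed.

(** Let [j] attain the maximum at z. Redrawing coordinate [e] cannot lower the
    maximum by more than it lowers the weight of [j], that is by z e - z' e if
    [e] is in [A j] and by nothing otherwise. At most [m] coordinates are
    concerned, each contributing (z e - z' e) ^ 2, truncated at level [L]. *)
Lemma maxlin_resample_sum (L : R) (z z' : I -> R) : 0 <= L ->
  \sum_e Num.max 0 (F z - F (upd z e (z' e))) ^+ 2 <=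
  4 * m%:R * L ^+ 2 +
  8 * expR (- L) * (\sum_i exp2 (z i) + \sum_i exp2 (z' i)).
Proof.
move=> L0; have [j Sj Fz] := maxlin_attained A Sj0 z.
pose c := 4 * expR (- L).
have c0 : 0 <= c by rewrite mulr_ge0 ?expR_ge0.
apply: (@le_trans _ _ (\sum_(e | A j e)
    2 * (2 * L ^+ 2 + c * (exp2 (z e) + exp2 (z' e))))).
  rewrite [leRHS]big_mkcond/=; apply: ler_sum => e _.
  have Fe : lin A (upd z e (z' e)) j <= F (upd z e (z' e)).
    exact: lin_le_maxlin.
  have zE : z = upd z e (z e).
    by apply/funext => i; rewrite /upd; case: eqP => [->|].
  have : F z - F (upd z e (z' e)) <= (A j e)%:R * (z e - z' e).
    rewrite Fz {1}zE; apply: le_trans (lerB (lexx _) Fe) _.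
    by rewrite (lin_upd A z e (z e)) (lin_upd A z e (z' e)); lra.
  case: ifP => Aje; last first.
    by rewrite mul0r => h; rewrite max_l// expr0n.
  rewrite mul1r => h.
  have := sqr_le_truncated (z e) L0; have := sqr_le_truncated (z' e) L0.
  rewrite -/c => h1 h2.
  apply: (@le_trans _ _ ((z e - z' e) ^+ 2)).
    have [h0|h0] := leP (F z - F (upd z e (z' e))) 0.
      by rewrite expr0n sqr_ge0.
    by rewrite lerXn2r ?nnegrE ?(ltW h0)// (le_trans (ltW h0)).
  by have := sqr_ge0 (z e + z' e); nra.
rewrite -mulr_sumr big_split/= sumr_const -mulr_sumr big_split/=.
have sub (u : I -> R) : \sum_(i | A j i) exp2 (u i) <= \sum_i exp2 (u i).
  rewrite [leRHS](bigID (A j))/= lerDl sumr_ge0// => i _.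
  by rewrite ltW ?exp2_gt0.
have := sub z; have := sub z'; have := Am Sj; rewrite -(ler_nat R).
set k := #|A j|; move=> km s1 s2.
have -> : 8 * expR (- L) = 2 * c by rewrite /c; ring.
have L2 := sqr_ge0 L.
rewrite -[X in X + _]mulr_natl.
have -> : 4 * m%:R * L ^+ 2 = 2 * (m%:R * (2 * L ^+ 2)) by ring.
rewrite -mulrA -mulrDr ler_wpM2l//; apply: lerD.
  by rewrite ler_wpM2r// mulr_ge0.
by rewrite ler_wpM2l// lerD.
Qed.

Variables (d : measure_display) (T : measurableType d) (P : probability T R).
Variables (X : I -> T -> R) (D : law) (M : R).
Hypotheses (lX : product_law P X (fun=> D)) (DM : moment_class M D).

Let iexp i : P.-integrable setT (EFin \o (exp2 \o X i)).
Proof.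
by apply: (marginal_integrable lX measurable_exp2); case: DM.
Qed.

(** The level [L] is such that the truncated parts of all the coordinates
    together contribute a constant. *)
Lemma maxlin_variance (L : R) : 0 <= L -> #|I|%:R <= expR L ->
  \int[P]_w (F (X ^~ w) ^+ 2) - (\int[P]_w F (X ^~ w)) ^+ 2 <=
  4 * m%:R * L ^+ 2 + 16 * M.
Proof.
move=> L0 IL; have [iD eM _ _] := DM.
have mF := borel_maxlin S A j0 : borel (F : (I -> R) -> R).
apply: le_trans (efron_stein lX iD mF dominated_maxlin_sqr) _.
have ipos e := integrable_resample lX iD mF dominated_maxlin_sqr e.
rewrite -Rintegral_sum//.
have l1 := product_law_fst lX lX; have l2 := product_law_snd lX lX.
have i1 i := marginal_integrable (i := i) l1 measurable_exp2 iD.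
have i2 i := marginal_integrable (i := i) l2 measurable_exp2 iD.
have e1 i : \int[(P \x P)%E]_w exp2 (X i w.1) <= M.
  by rewrite (marginal_Rintegral l1 measurable_exp2 iD).
have e2 i : \int[(P \x P)%E]_w exp2 (X i w.2) <= M.
  by rewrite (marginal_Rintegral l2 measurable_exp2 iD).
pose k := 8 * expR (- L).
have iS1 := integrable_Rsum i1.
have iS2 := integrable_Rsum i2.
have iS := integrableD measurableT iS1 iS2.
have ikS := integrableZl measurableT k iS.
set c := 4 * m%:R * L ^+ 2.
have ic := integrable_cst (P \x P)%E c.
apply: (@le_trans _ _ (\int[(P \x P)%E]_w (cst c w +
    k * (\sum_i exp2 (X i w.1) + \sum_i exp2 (X i w.2))))).
  apply: le_Rintegral => //; first exact: (integrable_Rsum ipos).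
    exact: (integrableD measurableT ic ikS).
  by move=> w _; exact: (maxlin_resample_sum (X ^~ w.1) (X ^~ w.2) L0).
rewrite RintegralD// Rintegral_prob_cst lerD2l RintegralZl// RintegralD//.
rewrite !Rintegral_sum//.
have sumM (f : I -> R) : (forall i, f i <= M) -> \sum_i f i <= #|I|%:R * M.
  move=> fM; apply: le_trans (ler_sum _ (fun i _ => fM i)) _.
  by rewrite sumr_const mulr_natl.
have := sumM _ e1; have := sumM _ e2 => s2 s1.
have M0 : 0 <= M.
  by apply: le_trans eM; apply: Rintegral_ge0 => x _; exact: expR_ge0.
have IL' : expR (- L) * #|I|%:R <= 1.
  by rewrite expRN mulrC ler_pdivrMr ?expR_gt0// mul1r.
apply: (@le_trans _ _ (k * (#|I|%:R * M + #|I|%:R * M))).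
  by rewrite ler_wpM2l ?mulr_ge0 ?expR_ge0// lerD.
have -> : k * (#|I|%:R * M + #|I|%:R * M) = 16 * M * (expR (- L) * #|I|%:R).
  by rewrite /k; ring.
by rewrite ler_piMr// mulr_ge0.
Qed.

Lemma maxlin_deviation (L t : R) : 0 <= L -> #|I|%:R <= expR L -> 0 < t ->
  (P [set w | t <= `|F (X ^~ w) - \int[P]_u F (X ^~ u)|]%R <=
   ((4 * m%:R * L ^+ 2 + 16 * M) / t ^+ 2)%:E)%E.
Proof.
move=> L0 IL t0; have [iD eM _ _] := DM.
have mF := borel_maxlin S A j0 : borel (F : (I -> R) -> R).
set a := \int[P]_u F (X ^~ u).
have iF := integrable_of_sqr lX iD mF dominated_maxlin_sqr.
have iF2 := integrable_sqr lX iD mF dominated_maxlin_sqr.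
have mY : measurable_fun setT (fun w => F (X ^~ w)) := borel_comp lX.1 mF.
pose Y : {RV P >-> R} := MeasurableFun.Pack (MeasurableFun.Class
  (isMeasurableFun.Build _ _ _ _ _ mY)).
have EY : fine 'E_P[Y] = a by rewrite unlock.
have iaF := integrableZl measurableT (2 * a) iF.
have iG := integrableB measurableT iF2 iaF.
have iGc := integrableD measurableT iG (integrable_cst P (a ^+ 2)).
have VE : 'V_P[Y] = (\int[P]_w ((F (X ^~ w) ^+ 2 - 2 * a * F (X ^~ w)) +
    cst (a ^+ 2) w))%:E.
  rewrite /variance covariance.unlock EY expectation.unlock /Rintegral fineK.
    by apply: eq_integral => w _ /=; congr EFin; rewrite /= fctE/=; ring.
  exact: integrable_fin_num.
have := chebyshev Y t0; rewrite EY VE => /le_trans; apply.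
rewrite -EFinM lee_fin mulrC ler_wpM2r ?invr_ge0 ?sqr_ge0//.
apply: le_trans (maxlin_variance L0 IL).
rewrite RintegralD//; last exact: integrable_cst.
rewrite RintegralB// RintegralZl// Rintegral_prob_cst -/a.
by apply: le_of_eq; ring.
Qed.

End MaxVariance.

(** * Exponential moments of sub-Gaussian laws *)

Section SubGaussianMoments.
Context {R : realType}.
Local Notation law := (probability (measurableTypeR R) R).

Let tail (n : nat) : set R := [set y | n.+1%:R / 2 < `|y|].

Let measurable_tail n : measurable (tail n).
Proof.
rewrite -[tail n]setTI.
by apply: (measurable_fun_ltr (f := cst (n.+1%:R / 2))).
Qed.

Let layer n (x : R) : R := expR (2 * n.+1%:R) * \1_(tail n) x.

Let layer_ge0 n x : 0 <= layer n x.
Proof. by rewrite mulr_ge0 ?expR_ge0. Qed.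

(** If |x| > 1 has integer part n, then n + 1 < 2 |x|, so that x is in the tail
    of index n, whose layer exceeds exp (2 |x|). *)
Let exp2_le_layers (x : R) :
  ((exp2 x)%:E <= (expR 2)%:E + \sum_(n <oo) (layer n x)%:E)%E.
Proof.
have [x1|x1] := leP `|x| 1.
  rewrite -[leLHS]adde0 leeD//; last first.
    by apply: nneseries_ge0 => n _ _; rewrite lee_fin.
  by rewrite lee_fin ler_expR; lra.
pose n := Num.truncn `|x|.
have /andP[nx xn] := truncn_itv (normr_ge0 x).
have tx : tail n x.
  rewrite /tail /= -natr1 -/n in xn nx *.
  have [n1|n1] := leqP n 1.
    have : n%:R <= 1 :> R by rewrite -[1]/(1%:R) ler_nat.
    by lra.
  have : 2 <= n%:R :> R by rewrite ler_nat.
  by lra.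
rewrite -[leLHS]add0e leeD ?lee_fin ?expR_ge0//.
apply: (@le_trans _ _ (layer n x)%:E).
  rewrite lee_fin /layer indicE mem_set// mulr1 ler_expR ler_wpM2l//.
  exact: ltW.
apply: le_trans (nneseries_lim_ge (m := 0) n.+1 _); last first.
  by move=> k _ _; rewrite lee_fin.
rewrite big_nat_recr//= leeDr// sume_ge0// => k _.
by rewrite lee_fin.
Qed.

(** With y = n + 1, the layer of index n has integral at most C exp (2 y - v (y
    / 2) ^ 2), and completing the square bounds the exponent by 9 / v - y; the
    layers are dominated by a geometric series. *)
Lemma sub_gaussian_integrable_exp2 (D : law) : sub_gaussian D ->
  D.-integrable setT (EFin \o exp2).
Proof.
move=> [C [v [C0 v0 Dtail]]]; apply/integrableP; split.
  by apply/measurable_EFinP; exact: measurable_exp2.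
have mlayer : forall n, measurable_fun [set: R] (EFin \o layer n).
  move=> n; apply/measurable_EFinP; rewrite /layer.
  apply: measurable_funM; first exact: measurable_cst.
  exact: (measurable_indic (measurable_tail n)).
pose B := 2 * C * expR (9 / v).
have layerD n :
    (\int[D]_x (layer n x)%:E <= (B / 2 / (2 ^ n.+1)%:R)%:E)%E.
  under eq_integral do rewrite EFinM.
  have m1 : measurable_fun [set: R] (EFin \o (\1_(tail n) : R -> R)).
    by apply/measurable_EFinP; exact: (measurable_indic (measurable_tail n)).
  rewrite (ge0_integralZl D measurableT m1)//; last first.
    by move=> x _; rewrite lee_fin.
  have -> : (\int[D]_x (\1_(tail n) x)%:E = D (tail n))%E.
    rewrite integral_indic//; first by congr (D _); exact: setIT.
    exact: measurable_tail.
  have n0 : 0 < n.+1%:R / 2 :> R by rewrite divr_gt0.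
  apply: (@le_trans _ _ ((expR (2 * n.+1%:R))%:E *
    (C * expR (- v * (n.+1%:R / 2) ^+ 2))%:E)%E).
    by rewrite lee_pmul2l ?lte_fin ?expR_gt0//; exact: Dtail.
  rewrite -EFinM lee_fin /B.
  set y : R := n.+1%:R.
  have -> : 2 * C * expR (9 / v) / 2 / (2 ^ n.+1)%:R =
      C * (expR (9 / v) * ((2 ^ n.+1)%:R)^-1).
    by field; rewrite pnatr_eq0 expn_eq0.
  have -> : expR (2 * y) * (C * expR (- v * (y / 2) ^+ 2)) =
      C * expR (2 * y - v * (y / 2) ^+ 2) by rewrite expRD mulNr; ring.
  rewrite ler_wpM2l ?(ltW C0)//.
  apply: (@le_trans _ _ (expR (9 / v - y))).
    rewrite ler_expR -subr_ge0.
    have -> : 9 / v - y - (2 * y - v * (y / 2) ^+ 2) =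
      v * (y / 2 - 3 / v) ^+ 2 by field; exact: lt0r_neq0.
    by rewrite mulr_ge0 ?sqr_ge0 ?(ltW v0).
  rewrite expRD ler_wpM2l ?expR_ge0// expRN.
  rewrite lef_pV2 ?posrE ?expR_gt0 ?ltr0n ?expn_gt0//.
  rewrite natrX /y -[n.+1%:R]mulr1 expRM_natl lerXn2r ?nnegrE ?expR_ge0//.
  by have := expR_ge1Dx (1 : R); lra.
have mseries : measurable_fun [set: R] (fun x => \sum_(n <oo) (layer n x)%:E)%E.
  apply: (@ge0_emeasurable_sum _ _ _ _ (fun n x => (layer n x)%:E) xpredT).
    by move=> k x _ _; rewrite lee_fin.
  by move=> k _; exact: mlayer.
under eq_integral do rewrite gee0_abs ?lee_fin ?expR_ge0//.
apply: (@le_lt_trans _ _ (\int[D]_x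
    ((expR 2)%:E + \sum_(n <oo) (layer n x)%:E))%E).
  apply: ge0_le_integral => //.
  - by move=> x _; rewrite lee_fin expR_ge0.
  - by apply/measurable_EFinP; exact: measurable_exp2.
  - exact: (emeasurable_funD (measurable_cst (expR 2)%:E) mseries).
  - by move=> x _; exact: exp2_le_layers.
rewrite ge0_integralD//; last first.
  by move=> x _; apply: nneseries_ge0 => n _ _; rewrite lee_fin.
have -> : (\int[D]__ (expR 2)%:E = (expR 2)%:E)%E.
  rewrite integral_cst// -[RHS]mule1; congr (_ * _)%E.
  exact: probability_setT.
rewrite integral_nneseries//; last by move=> n x _; rewrite lee_fin.
apply: (@le_lt_trans _ _ ((expR 2)%:E + (B / 2)%:E)%E); last first.
  by rewrite -EFinD ltry.
rewrite leeD2l//.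
apply: (@le_trans _ _ (\sum_(n <oo) (B / 2 / (2 ^ n.+1)%:R)%:E)%E).
  apply: lee_nneseries => // n _ _.
  by apply: integral_ge0 => x _; rewrite lee_fin.
apply: epsilon_trick0.
by rewrite divr_ge0// mulr_ge0 ?expR_ge0// mulr_ge0// ltW.
Qed.

End SubGaussianMoments.

(** * Moments of the normal law *)

Section NormalMoments.
Context {R : realType}.
Local Notation leb := (@lebesgue_measure R).

Section Density.
Variables (m s : R).
Local Notation N := (@normal_prob R m s).
Local Notation pdf := (normal_pdf m s).

Let pdf0 x : 0 <= pdf x. Proof. exact: normal_pdf_ge0. Qed.

Let mpdf : measurable_fun [set: R] (EFin \o pdf).
Proof. by apply/measurable_EFinP; exact: measurable_normal_pdf. Qed.

Let integral_indic_density (E : set R) : measurable E ->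
  (\int[N]_x (\1_E x)%:E = \int[leb]_x ((\1_E x)%:E * (pdf x)%:E))%E.
Proof.
move=> mE; rewrite integral_indic// setIT.
transitivity (\int[leb]_(x in E) (pdf x)%:E)%E; first by [].
rewrite integral_mkcond; apply: eq_integral => x _.
rewrite patchE indicE; case: ifPn => _; first by rewrite mul1e.
by rewrite mul0e.
Qed.

Import HBNNSimple.

Let integral_nnsfun_density (f : {nnsfun _ >-> R}) :
  (\int[N]_x (f x)%:E = \int[leb]_x ((f x)%:E * (pdf x)%:E))%E.
Proof.
under [LHS]eq_integral do rewrite fimfunE -fsumEFin//.
rewrite [LHS]ge0_integral_fsum//; last 2 first.
  - by move=> r; exact/measurable_EFinP/measurableT_comp.
  - by move=> n x _; rewrite EFinM nnfun_muleindic_ge0.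
have mulE x : ((f x)%:E * (pdf x)%:E = \sum_(r \in range f)
    ((pdf x)%:E * (r * \1_(f @^-1` [set r]) x)%:E))%E.
  rewrite [in LHS]fimfunE -fsumEFin// muleC ge0_mule_fsumr// => r.
  by rewrite EFinM nnfun_muleindic_ge0.
under [RHS]eq_integral do rewrite mulE.
rewrite [RHS]ge0_integral_fsum//; last 2 first.
  - move=> r; apply: emeasurable_funM => //.
    by apply/measurable_EFinP/measurableT_comp.
  - move=> n x _; rewrite mule_ge0 ?lee_fin//.
    by rewrite -lee_fin EFinM nnfun_muleindic_ge0.
apply: eq_fsbigr => r _.
rewrite integralZl_indic_nnsfun//= integral_indic_density//.
have [r0|r0] := leP 0 r; last first.
  have -> : f @^-1` [set r] = set0.
    by apply/seteqP; split => // x /= fx; move: r0; rewrite -fx ltNge fun_ge0.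
  by rewrite indic0 !integral0_eq ?mule0// => x _;
    rewrite /= ?mulr0 ?mule0 ?mul0e.
rewrite -ge0_integralZl//; first last.
- by move=> x _; rewrite mule_ge0 ?lee_fin.
- apply: emeasurable_funM => //.
  exact/measurable_EFinP/measurable_indic.
by apply: eq_integral => x _; rewrite -!EFinM; congr EFin; ring.
exact: (measurable_sfunP _ (measurable_set1 r)).
Qed.

(** The density is passed from indicators to simple functions and then to
    limits by monotone convergence. *)
Lemma ge0_integral_normal_prob (f : R -> R) :
  measurable_fun [set: R] f -> (forall x, 0 <= f x) ->
  (\int[N]_x (f x)%:E = \int[leb]_x (f x * pdf x)%:E)%E.
Proof.
move=> mf f0.
have mf' : measurable_fun [set: measurableTypeR R] (EFin \o f).
  exact/measurable_EFinP.
pose f_ := nnsfun_approx measurableT mf'.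
have f_lim x : (EFin \o f_ ^~ x) @ \oo --> (f x)%:E.
  by apply: cvg_nnsfun_approx => // y _; rewrite lee_fin.
have f_nd : {homo f_ : a b / (a <= b)%N >-> forall x, a x <= b x}.
  by move=> a b ab x; exact/lefP/nd_nnsfun_approx.
transitivity (lim (\int[N]_x (f_ n x)%:E @[n --> \oo])%E).
  rewrite -monotone_convergence//=.
  - by apply: eq_integral => x _; apply/esym/cvg_lim => //; exact: f_lim.
  - by move=> n; exact/measurable_EFinP/measurable_funTS.
  - by move=> n x _; rewrite lee_fin.
  - by move=> x _ a b ab; rewrite lee_fin; exact: f_nd.
under eq_fun do rewrite integral_nnsfun_density.
rewrite -monotone_convergence//=.
- apply: eq_integral => x _; apply/cvg_lim => //.
  rewrite EFinM; apply: cvgeM => //; last exact: cvg_cst.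
  exact: f_lim.
- move=> n; apply: emeasurable_funM => //.
  exact/measurable_EFinP/measurable_funTS.
- by move=> n x _; rewrite mule_ge0 ?lee_fin.
- move=> x _ a b ab; rewrite lee_wpmul2r ?lee_fin//; exact: f_nd.
Qed.

End Density.
Let measurable_expRM (a : R) : measurable_fun [set: R] (fun x => expR (a * x)).
Proof. by apply: measurableT_comp => //; exact: measurable_funM. Qed.

(** Completing the square, exp (a x) times the normal density is a constant
    times the normal density with the mean shifted by a * s ^ 2. *)
Lemma normal_mgf (m s a : R) : s != 0 ->
  (\int[@normal_prob R m s]_x (expR (a * x))%:E =
   (expR (a * m + a ^+ 2 * s ^+ 2 / 2))%:E)%E.
Proof.
move=> s0.
rewrite (ge0_integral_normal_prob _ _ (measurable_expRM a))//.
set c := expR (a * m + _).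
have shift x : (expR (a * x) * normal_pdf m s x)%:E =
    (c%:E * (normal_pdf (m + a * s ^+ 2) s x)%:E)%E.
  rewrite -EFinM !normal_pdfE// /normal_fun.
  rewrite mulrCA [in RHS]mulrCA -!expRD; congr (_ * expR _)%:E.
  by rewrite -[s ^+ 2 *+ 2]mulr_natr; field.
under eq_integral do rewrite shift.
rewrite ge0_integralZl//.
- by rewrite integral_normal_pdf mule1.
- by apply/measurable_EFinP; exact: measurable_normal_pdf.
- by move=> x _; rewrite lee_fin normal_pdf_ge0.
- by rewrite lee_fin expR_ge0.
Qed.

Lemma expR_taylor2 (u : R) :
  `|expR u - (1 + u + u ^+ 2 / 2)| <= expR `|u| * `|u| ^+ 3.
Proof.
set M := expR `|u|; have M0 : 0 <= M by exact: expR_ge0.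
have B0 t : `|t| <= `|u| -> `|expR t| <= M.
  move=> tu; rewrite ger0_norm ?expR_ge0// ler_expR.
  exact: le_trans (ler_norm t) tu.
have B1 t : `|t| <= `|u| -> `|expR t - 1| <= M * `|u|.
  move=> tu; have := mean_value_bound (u := t) (C := M)
    (fun t => is_derive_expR t) (fun s st => B0 s (le_trans st tu)).
  by rewrite expR0 => /le_trans; apply; rewrite ler_wpM2l.
have d1 (t : R) : is_derive t 1 (fun t => expR t - t) (expR t - 1).
  exact: is_deriveB.
have B2 t : `|t| <= `|u| -> `|expR t - 1 - t| <= M * `|u| ^+ 2.
  move=> tu; have := mean_value_bound (u := t) (C := M * `|u|)
    d1 (fun s st => B1 s (le_trans st tu)).
  rewrite expR0 subr0 addrAC => /le_trans; apply.
  by rewrite expr2 mulrA ler_wpM2l// mulr_ge0.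
have d2 (t : R) : is_derive t 1 (fun t => expR t - t - 2^-1 * t ^+ 2)
    (expR t - 1 - t).
  by apply: is_derive_eq; rewrite /GRing.scale /=; field.
have := mean_value_bound d2 B2.
rewrite expR0 expr0n /= mulr0 !subr0 -mulrA -exprSr.
by congr (`| _ | <= _); field.
Qed.

Lemma eq0_of_le_small (a K : R) :
  (forall t, 0 < t <= 1 -> `|a| <= K * t) -> a = 0.
Proof.
move=> h; apply/eqP; rewrite -normr_le0 leNgt; apply/negP => a0.
have K0 : 0 < K.
  by have := h 1; rewrite ltr01 lexx mulr1 => /(_ isT); exact: lt_le_trans.
(* This value of t is in ]0, 1], and K * t < `|a|. *)
have := h (`|a| / (K + `|a|)).
rewrite divr_gt0 ?addr_gt0// ler_pdivrMr ?addr_gt0// mul1r lerDr ltW//.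
move=> /(_ isT); rewrite mulrA ler_pdivlMr ?addr_gt0//; nra.
Qed.

Local Notation N := (normal_half_quarter R).

Let mgfN (a : R) :
  (\int[N]_x (expR (a * x))%:E = (expR (a / 2 + a ^+ 2 / 8))%:E)%E.
Proof.
rewrite normal_mgf; last by rewrite mulf_neq0.
by congr (expR _)%:E; field.
Qed.

Let integrable_expRM (a : R) :
  N.-integrable setT (EFin \o (fun x => expR (a * x))).
Proof.
apply/integrableP; split.
  by apply/measurable_EFinP; exact: measurable_expRM.
under eq_integral do rewrite gee0_abs ?lee_fin ?expR_ge0//.
by rewrite mgfN ltry.
Qed.

Lemma normal_integrable_exp2 : N.-integrable setT (EFin \o exp2).
Proof.
have := integrableD measurableT (integrable_expRM 2) (integrable_expRM (- 2)).
apply: integrable_le => [|x]; first exact: measurable_exp2.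
rewrite ger0_norm ?expR_ge0// /exp2; have [x0|x0] := leP 0 x.
  by rewrite ger0_norm// lerDl expR_ge0.
by rewrite ltr0_norm// mulrN -mulNr lerDr expR_ge0.
Qed.

(** The moments are read off the expansion at 0 of the moment generating
    function: E exp (a X) is 1 + a E X + a ^ 2 E X ^ 2 / 2 up to O(a ^ 3), and
    equals exp (a / 2 + a ^ 2 / 8), which is 1 + a / 2 + a ^ 2 / 4 up to O(a ^
    3). *)
Lemma normal_mean_moment2 :
  \int[N]_x x = 1 / 2 /\ \int[N]_x (x ^+ 2) = 1 / 2.
Proof.
pose M := \int[N]_x exp2 x.
set m1 := \int[N]_x x; set m2 := \int[N]_x (x ^+ 2).
have expand (a : R) : 0 < a <= 1 ->
    `|a * (m1 - 1 / 2) + a ^+ 2 * ((m2 - 1 / 2) / 2)| <=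
    (27 * M + expR 1 + 1) * a ^+ 3.
  move=> /andP[a0 a1].
  have := quadratic_approx_Rintegral normal_integrable_exp2 (lexx M)
    (f := fun x => expR (a * x)) (c0 := 1) (c1 := a) (c2 := a ^+ 2 / 2)
    (k := 27 * a ^+ 3).
  rewrite -/m1 -/m2 /Rintegral mgfN /= => /(_ _ (integrable_expRM a)).
  have k0 : 0 <= 27 * a ^+ 3 by rewrite mulr_ge0 ?exprn_ge0 ?(ltW a0).
  have bnd x : `|expR (a * x) - (1 + a * x + a ^+ 2 / 2 * x ^+ 2)| <=
      27 * a ^+ 3 * exp2 x.
    have := expR_taylor2 (a * x).
    have -> : 1 + a * x + a ^+ 2 / 2 * x ^+ 2 =
        1 + a * x + (a * x) ^+ 2 / 2 by field.
    rewrite normrM (gtr0_norm a0) => /le_trans; apply.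
    have -> : expR (a * `|x|) * (a * `|x|) ^+ 3 =
        a ^+ 3 * (expR (a * `|x|) * `|x| ^+ 3) by ring.
    have -> : 27 * a ^+ 3 * exp2 x =
        a ^+ 3 * (expR `|x| * (27 * expR `|x|)).
      by rewrite /exp2 (_ : 2 * `|x| = `|x| + `|x|) ?expRD; ring.
    rewrite ler_wpM2l ?exprn_ge0 ?(ltW a0)// ler_pM ?expR_ge0 ?exprn_ge0//.
      by rewrite ler_expR ler_piMl.
    exact: cube_le_expR.
  move=> /(_ k0 bnd).
  set v := a / 2 + a ^+ 2 / 8.
  have v0 : 0 <= v by rewrite addr_ge0 ?divr_ge0 ?sqr_ge0 ?(ltW a0).
  have va : v <= a.
    have : a ^+ 2 <= a by rewrite expr2 ler_piMl ?(ltW a0).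
    by rewrite /v; lra.
  have a3 : 0 <= a ^+ 3 by rewrite exprn_ge0 ?(ltW a0).
  have := expR_taylor2 v; rewrite (ger0_norm v0).
  have : expR v * v ^+ 3 <= expR 1 * a ^+ 3.
    rewrite ler_pM ?expR_ge0 ?exprn_ge0//.
      by rewrite ler_expR (le_trans va).
    by rewrite lerXn2r ?nnegrE ?(ltW a0).
  have v2 : 1 + v + v ^+ 2 / 2 =
      1 + a / 2 + a ^+ 2 / 4 + a ^+ 3 / 16 + a ^+ 3 * a / 128.
    by rewrite /v; field.
  have a4 : 0 <= a ^+ 3 * a <= a ^+ 3.
    by rewrite mulr_ge0 ?(ltW a0)//= ler_piMr.
  rewrite v2; set E := expR v; set e := expR 1.
  move: a4 a3; set a3 := a ^+ 3; set a2 := a ^+ 2; set a4 := a3 * a.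
  move=> /andP[a40 a43] a30 h1 h2 h3.
  have -> : a * (m1 - 1 / 2) + a2 * ((m2 - 1 / 2) / 2) =
    (E - (1 + a / 2 + a2 / 4 + a3 / 16 + a4 / 128)) -
    (E - (1 + a * m1 + a2 / 2 * m2)) + (a3 / 16 + a4 / 128) by field.
  have -> : (27 * M + e + 1) * a3 = e * a3 + 27 * a3 * M + a3 by ring.
  apply: le_trans (ler_normD _ _) _; apply: lerD.
    apply: le_trans (ler_normB _ _) _; apply: lerD => //.
    exact: le_trans h2 h1.
  by rewrite ger0_norm; lra.
set K := 27 * M + expR 1 + 1 in expand.
(* Divide by a and let a tend to 0; the coefficient of a ^ 2 is next. *)
have first : m1 - 1 / 2 = 0.
  apply: (@eq0_of_le_small _ (K + `|(m2 - 1 / 2) / 2|)) => a /andP[a0 a1].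
  have := expand a; rewrite a0 a1 => /(_ isT) h.
  rewrite -(ler_pM2l a0) -{1}(gtr0_norm a0) -normrM.
  have -> : a * (m1 - 1 / 2) =
    (a * (m1 - 1 / 2) + a ^+ 2 * ((m2 - 1 / 2) / 2)) -
    a ^+ 2 * ((m2 - 1 / 2) / 2) by ring.
  apply: le_trans (ler_normB _ _) _.
  rewrite [X in _ + X <= _]normrM (ger0_norm (sqr_ge0 a)).
  have -> : a * ((K + `|(m2 - 1 / 2) / 2|) * a) =
    K * a ^+ 2 + a ^+ 2 * `|(m2 - 1 / 2) / 2| by ring.
  rewrite lerD2r; apply: le_trans h _.
  have K0 : 0 <= K.
    have M0 : 0 <= M by apply: Rintegral_ge0 => x _; exact: expR_ge0.
    by rewrite /K addr_ge0 ?addr_ge0 ?mulr_ge0 ?expR_ge0.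
  by rewrite ler_wpM2l// exprS ler_piMl ?sqr_ge0.
have second : (m2 - 1 / 2) / 2 = 0.
  apply: (@eq0_of_le_small _ K) => a /andP[a0 a1].
  have := expand a; rewrite a0 a1 first mulr0 add0r => /(_ isT).
  have -> : K * a ^+ 3 = a ^+ 2 * (K * a) by ring.
  rewrite normrM (ger0_norm (sqr_ge0 a)).
  by rewrite ler_pM2l ?exprn_gt0.
by split; lra.
Qed.

End NormalMoments.

(** * Edges inside vertex subsets, and sizes *)

Section CompleteGraph.
Variables n k : nat.

Definition spanned (V : {set 'I_n}) : pred (edge n) :=
  fun e => ((val e).1 \in V) && ((val e).2 \in V).

Definition k_subset : pred {set 'I_n} := fun V => #|V| == k.

Definition initial_set : {set 'I_n} := [set i : 'I_n | (i < k)%N]%SET.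

Lemma card_initial_set : (k <= n)%N -> k_subset initial_set.
Proof.
move=> kn; rewrite /k_subset /initial_set.
have -> : [set i : 'I_n | (i < k)%N]%SET =
    ((widen_ord kn) @: [set: 'I_k])%SET.
  apply/setP => i; rewrite finset.inE.
  apply/idP/imsetP => [ik|[j _ ->]]; last exact: (ltn_ord j).
  by exists (Ordinal ik); rewrite ?finset.inE//; exact: val_inj.
rewrite card_imset ?cardsT ?card_ord// => i j /(congr1 val) /= ij.
exact: val_inj.
Qed.

Lemma card_spanned V : k_subset V -> (#|spanned V| <= k ^ 2)%N.
Proof.
move=> /eqP Vk; rewrite -(fintype.card_image val_inj) -mulnn -Vk -cardsX.
apply: subset_leq_card; apply/fintype.subsetP => _ /fintype.imageP[e eV ->].
by rewrite !finset.inE.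
Qed.

Lemma card_k_subset : #|k_subset| = 'C(n, k).
Proof.
have := card_draws 'I_n k; rewrite card_ord => <-.
by apply: eq_card => V; rewrite finset.inE.
Qed.

Lemma card_edge : (#|edge n| <= n ^ 2)%N.
Proof.
rewrite card_sig (leq_trans (max_card _))// card_prod !card_ord.
by rewrite mulnn.
Qed.

End CompleteGraph.

Lemma bin_le_expn n k : ('C(n, k) <= n ^ k)%N.
Proof.
elim: k => [|k IH]; first by rewrite bin0.
apply: (@leq_trans (k.+1 * 'C(n, k.+1))); first exact: leq_pmull.
by rewrite mul_bin_left expnS leq_mul// leq_subr.
Qed.

Section Sizes.
Context {R : realType}.
Variable alpha : R.
Hypotheses (alpha0 : 0 < alpha) (alpha1 : alpha < 1).

Lemma Ksize_le n : (0 < n)%N -> (Ksize alpha n <= n)%N.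
Proof.
move=> n0; rewrite -(ler_nat R) /Ksize.
have n1 : 1 <= n%:R :> R by rewrite ler1n.
have /andP[h _] := truncn_itv (powR_ge0 n%:R alpha).
apply: le_trans h _; rewrite -[leRHS]powRr1//.
by rewrite ler_powR// ltW.
Qed.

(** With x = alpha ln n, this follows from n ^ alpha = exp x >= (x / 2) ^ 2,
    which dominates x / alpha + 1 when x >= 4 / alpha + 1. *)
Lemma Ksize_ge_ln n : (0 < n)%N -> (4 / alpha + 1) / alpha <= ln n%:R ->
  ln n%:R <= (Ksize alpha n)%:R :> R.
Proof.
move=> n0 nL.
have n1 : 0 < n%:R :> R by rewrite ltr0n.
have /andP[_] := truncn_itv (powR_ge0 n%:R alpha).
rewrite -natr1 -/(Ksize alpha n) => h.
suff : ln n%:R + 1 <= n%:R `^ alpha by lra.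
rewrite /powR gt_eqF//; set x := alpha * ln n%:R.
have lnE : ln n%:R = x / alpha by rewrite /x mulrC mulKf ?gt_eqF.
have xL : 4 / alpha + 1 <= x.
  by move: nL; rewrite ler_pdivrMr// [_ * alpha]mulrC.
have a4 : 4 <= 4 / alpha by rewrite ler_pdivlMr//; have A1 := alpha1; lra.
have e : (x / 2) ^+ 2 <= expR x.
  have -> : expR x = expR (x / 2) ^+ 2.
    by rewrite -expRM_natl; congr expR; field.
  by rewrite lerXn2r ?nnegrE ?expR_ge0//; have := expR_ge1Dx (x / 2); lra.
apply: le_trans e; rewrite lnE.
have -> : (x / 2) ^+ 2 = x * (x - 4 / alpha) / 4 + x / alpha.
  by field; rewrite gt_eqF.
have : 4 <= x * (x - 4 / alpha) by nra.
lra.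
Qed.

(** All the powers in play are powers of the cube roots of [K] and of [ln n];
    in these the estimates become polynomial. *)
Definition cbrt (x : R) : R := x `^ (1 / 3).

Lemma cbrt_gt0 x : 0 < x -> 0 < cbrt x.
Proof. exact: powR_gt0. Qed.

Lemma cbrt_ge1 x : 1 <= x -> 1 <= cbrt x.
Proof. by move=> x1; rewrite -(powRr0 x) ler_powR// divr_ge0. Qed.

Lemma powR_thirds x (j : nat) : 0 <= x -> x `^ (j%:R / 3) = cbrt x ^+ j.
Proof.
move=> x0; rewrite -powR_mulrn ?powR_ge0// /cbrt -powRrM.
by congr (x `^ _); field.
Qed.

Lemma cbrtK x : 0 <= x -> cbrt x ^+ 3 = x.
Proof. by move=> x0; rewrite -powR_thirds// divff// powRr1. Qed.

Lemma cbrt_ge x y : 0 <= x -> x ^+ 3 <= y -> x <= cbrt y.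
Proof.
move=> x0 xy; have y0 : 0 <= y by apply: le_trans xy; exact: exprn_ge0.
by rewrite -(ler_pXn2r (n := 3))// ?nnegrE ?powR_ge0// cbrtK.
Qed.

Lemma rate_ge n : 1 <= ln (n%:R : R) ->
  cbrt (Ksize alpha n)%:R ^+ 4 * cbrt (ln (n%:R : R)) ^+ 3 <= rate alpha n.
Proof.
move=> l1; rewrite /rate powR_thirds// ler_wpM2l ?exprn_ge0 ?powR_ge0//.
have l0 : 0 <= ln n%:R :> R by apply: le_trans l1.
by rewrite -powR_thirds// ler_powR//; lra.
Qed.

End Sizes.

(** * The two estimates *)

Section MainEstimates.
Context {R : realType}.
Local Notation law := (probability (measurableTypeR R) R).
Variable alpha : R.
Hypotheses (alpha0 : 0 < alpha) (alpha1 : alpha < 1).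
Local Notation K n := (Ksize alpha n).

(** The relations between n, ln n and K that the estimates rely on; they hold
    for all n beyond a bound depending on alpha. *)
Definition large (n : nat) : Prop :=
  [/\ (0 < n)%N, 1 <= ln (n%:R : R), ln (n%:R : R) <= (K n)%:R & (K n <= n)%N].

Lemma ln_eventually_ge (x : R) : \forall n \near \oo, x <= ln (n%:R : R).
Proof.
near=> n.
have nx : expR x <= n%:R by near: n; exact: nbhs_infty_ger.
by rewrite -[x]expRK ler_ln ?posrE ?expR_gt0// (lt_le_trans _ nx) ?expR_gt0.
Unshelve. all: by end_near. Qed.

Lemma large_eventually : \forall n \near \oo, large n.
Proof.
near=> n.
have n0 : (0 < n)%N by near: n; exact: nbhs_infty_gt.
have l1 : 1 <= ln (n%:R : R) by near: n; exact: ln_eventually_ge.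
have lL : (4 / alpha + 1) / alpha <= ln (n%:R : R).
  by near: n; exact: ln_eventually_ge.
by split => //; [exact: Ksize_ge_ln|exact: Ksize_le].
Unshelve. all: by end_near. Qed.

Variables (D N : law) (M : R).
Hypotheses (DM : moment_class M D) (NM : moment_class M N).

(** With u and t the cube roots of K and ln n, the choice b = t / u makes the
    gap K ln n / b and the replacement error b ^ 2 * K ^ 2 both equal to u ^ 4
    * t ^ 2. *)
Lemma Psi_expectation_compare n d1 d2 (T1 : measurableType d1)
    (T2 : measurableType d2) (P1 : probability T1 R) (P2 : probability T2 R)
    (Z : edge n -> T1 -> R) (W : edge n -> T2 -> R) : large n ->
  product_law P1 Z (fun=> D) -> product_law P2 W (fun=> N) ->
  `|\int[P1]_w Psi (K n) (Z ^~ w) - \int[P2]_w Psi (K n) (W ^~ w)| <=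
  (1 + 432 * M) * rate alpha n.
Proof.
move=> [n0 l1 lK Kn] lZ lW.
have M0 : 0 <= M.
  have [_ eM _ _] := DM; apply: le_trans eM; apply: Rintegral_ge0 => x _.
  exact: expR_ge0.
have l0 : 0 < ln (n%:R : R) by apply: lt_le_trans l1.
have K0 : 0 < (K n)%:R :> R by apply: lt_le_trans lK.
pose u := cbrt ((K n)%:R : R); pose t := cbrt (ln (n%:R : R)).
have u0 : 0 < u by exact: cbrt_gt0.
have t0 : 0 < t by exact: cbrt_gt0.
have uK : u ^+ 3 = (K n)%:R by rewrite cbrtK// ltW.
have tl : t ^+ 3 = ln n%:R by rewrite cbrtK// ltW.
have t1 : 1 <= t by exact: cbrt_ge1.
have tu : t <= u by rewrite ge0_ler_powR ?nnegrE// ltW.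
have b01 : 0 < t / u <= 1 by rewrite divr_gt0//= ler_pdivrMr// mul1r.
have ns : k_subset (K n) (initial_set n (K n)) by exact: card_initial_set.
have := maxlin_compare ns (fun V => @card_spanned n (K n) V) lZ lW DM NM b01.
move=> /le_trans; apply.
have lnC : ln #|k_subset (n := n) (K n)|%:R <= (K n)%:R * ln n%:R :> R.
  rewrite card_k_subset mulr_natl -lnXn ?ltr0n// ler_ln ?posrE.
  - by rewrite -natrX ler_nat bin_le_expn.
  - by rewrite ltr0n bin_gt0.
  - by rewrite exprn_gt0// ltr0n.
have rK := rate_ge alpha l1.
have tt : u ^+ 4 * t ^+ 2 <= rate alpha n.
  apply: le_trans rK; rewrite -/u -/t ler_wpM2l ?exprn_ge0 ?(ltW u0)//.
  by rewrite [t ^+ 3]exprS ler_peMl ?sqr_ge0.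
apply: (@le_trans _ _ ((1 + 432 * M) * (u ^+ 4 * t ^+ 2))); last first.
  have c0 : 0 <= 1 + 432 * M.
    apply: addr_ge0; first exact: ler01.
    by apply: mulr_ge0; [exact: ler0n|exact: M0].
  exact: (ler_wpM2l c0 tt).
rewrite [leRHS]mulrDl mul1r; apply: lerD.
  rewrite ler_pdivrMr ?divr_gt0//; apply: le_trans lnC _.
  rewrite -uK -tl; apply: le_of_eq.
  by field; rewrite gt_eqF.
rewrite natrX -uK; apply: le_of_eq.
by field; rewrite gt_eqF.
Qed.

(** Chebyshev's inequality: with u and t the cube roots of K and ln n, the
    variance is O(u ^ 6 * t ^ 6) while the rate is at least u ^ 4 * t ^ 3. The
    level 2 ln n matches the number of edges, at most n ^ 2. *)
Lemma Psi_deviation n d (T : measurableType d) (P : probability T R)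
    (Z : edge n -> T -> R) (E : law) : large n ->
  product_law P Z (fun=> E) -> moment_class M E ->
  (P [set w | rate alpha n <=
     `|Psi (K n) (Z ^~ w) - \int[P]_v Psi (K n) (Z ^~ v)|]%R <=
   (16 * (1 + M) / cbrt (K n)%:R)%:E)%E.
Proof.
move=> [n0 l1 lK Kn] lZ EM.
have M0 : 0 <= M.
  have [_ eM _ _] := EM; apply: le_trans eM; apply: Rintegral_ge0 => x _.
  exact: expR_ge0.
have l0 : 0 < ln (n%:R : R) by apply: lt_le_trans l1.
have K0 : 0 < (K n)%:R :> R by apply: lt_le_trans lK.
have K1 : 1 <= (K n)%:R :> R by apply: le_trans lK.
pose u := cbrt ((K n)%:R : R); pose t := cbrt (ln (n%:R : R)).
have u1 : 1 <= u.
  by exact: cbrt_ge1.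
have u0 : 0 < u by apply: lt_le_trans u1.
have t1 : 1 <= t by exact: cbrt_ge1.
have t0 : 0 < t by apply: lt_le_trans t1.
have uK : u ^+ 3 = (K n)%:R by rewrite cbrtK// ltW.
have tl : t ^+ 3 = ln n%:R by rewrite cbrtK// ltW.
have rK : u ^+ 4 * t ^+ 3 <= rate alpha n := rate_ge alpha l1.
have ut0 : 0 < u ^+ 4 * t ^+ 3 by rewrite mulr_gt0 ?exprn_gt0.
have r0 : 0 < rate alpha n by apply: lt_le_trans rK.
have ns : k_subset (K n) (initial_set n (K n)) by exact: card_initial_set.
have L0 : 0 <= 2 * ln (n%:R : R) by rewrite mulr_ge0 ?ltW.
have IL : #|edge n|%:R <= expR (2 * ln n%:R) :> R.
  by rewrite expRM_natl lnK ?posrE ?ltr0n// -natrX ler_nat card_edge.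
have := maxlin_deviation ns (fun V => @card_spanned n (K n) V) lZ EM L0 IL r0.
move=> /le_trans; apply; rewrite lee_fin -/u natrX -uK -tl.
apply: (@le_trans _ _ ((16 * (1 + M) * (u ^+ 6 * t ^+ 6)) /
    (u ^+ 4 * t ^+ 3) ^+ 2)).
  rewrite ler_pM ?invr_ge0 ?sqr_ge0//.
  - apply: addr_ge0; apply: mulr_ge0; rewrite ?ler0n ?sqr_ge0 //.
    by apply: mulr_ge0; rewrite ?ler0n ?sqr_ge0.
  - have : 1 <= u ^+ 6 * t ^+ 6 by rewrite mulr_ege1 ?exprn_ege1.
    have -> : 4 * (u ^+ 3) ^+ 2 * (2 * t ^+ 3) ^+ 2 = 16 * (u ^+ 6 * t ^+ 6).
      by ring.
    by nra.
  - rewrite lef_pV2 ?posrE ?exprn_gt0//.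
    by rewrite lerXn2r ?nnegrE ?(ltW ut0) ?(ltW r0).
have -> : 16 * (1 + M) * (u ^+ 6 * t ^+ 6) / (u ^+ 4 * t ^+ 3) ^+ 2 =
    16 * (1 + M) / u / u by field; rewrite !gt_eqF.
have c0 : 0 <= 16 * (1 + M) / u.
  apply: mulr_ge0; last by rewrite invr_ge0 ltW.
  by apply: mulr_ge0; [exact: ler0n|rewrite addr_ge0].
by rewrite ler_piMr// invf_le1.
Qed.

End MainEstimates.

Section Conclusion.
Context {R : realType}.
Local Notation law := (probability (measurableTypeR R) R).

Lemma moment_class_of_expectation (D : law) (M : R) :
  D.-integrable setT (EFin \o exp2) -> \int[D]_x exp2 x <= M ->
  ('E_D[fun x : R => x] = (1 / 2)%:E)%E ->
  ('E_D[fun x : R => (x ^+ 2)%R] = (1 / 2)%:E)%E -> moment_class M D.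
Proof.
by move=> iD eM; rewrite expectation.unlock => m1 m2; split => //;
  rewrite /Rintegral ?m1 ?m2.
Qed.

Variable alpha : R.
Local Notation K n := (Ksize alpha n).
Variables (D N : law) (M : R).
Hypotheses (DM : moment_class M D) (NM : moment_class M N).

Lemma expectation_Psi n d (T : measurableType d) (P : probability T R)
    (Z : edge n -> T -> R) (E : law) : large alpha n ->
  product_law P Z (fun=> E) -> moment_class M E ->
  ('E_P[fun w => Psi (K n) (Z ^~ w)] =
    (\int[P]_w Psi (K n) (Z ^~ w))%:E)%E.
Proof.
move=> [_ _ _ Kn] lZ EM.
have ns : k_subset (K n) (initial_set n (K n)) by exact: card_initial_set.
rewrite expectation.unlock /Rintegral fineK//.
apply: integrable_fin_num => //.
exact: (maxlin_integrable (@spanned n) ns lZ EM).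
Qed.

Hypotheses (alpha0 : 0 < alpha) (alpha1 : alpha < 1).

(** Outside two events of small probability each maximum is within [rate] of
    its expectation, which explains the two additional rates. *)
Lemma Psi_close_probability (d : nat -> measure_display)
    (T : forall n, measurableType (d n)) (P : forall n, probability (T n) R)
    (Z W : forall n, edge n -> T n -> R) :
  (forall n, product_law (P n) (Z n) (fun=> D)) ->
  (forall n, product_law (P n) (W n) (fun=> N)) ->
  P n [set w | `|Psi (K n) (Z n ^~ w) - Psi (K n) (W n ^~ w)| <=
               (1 + 432 * M + 2) * rate alpha n] @[n --> \oo] --> 1%E.
Proof.
move=> lZ lW; pose C := 1 + 432 * M.
pose G n := [set w | `|Psi (K n) (Z n ^~ w) - Psi (K n) (W n ^~ w)| <=
               (1 + 432 * M + 2) * rate alpha n].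
have mPsi n (X : edge n -> T n -> R) E : product_law (P n) X (fun=> E) ->
    measurable_fun setT (fun w => Psi (K n) (X ^~ w)).
  move=> lX; exact: (borel_comp lX.1
    (borel_maxlin (k_subset (K n)) (@spanned n) (initial_set n (K n)))).
have mG n : measurable (G n).
  rewrite -[G n]setTI; apply: (measurable_fun_ler (f := fun w =>
    `|Psi (K n) (Z n ^~ w) - Psi (K n) (W n ^~ w)|)) => //.
  apply: measurableT_comp => //.
  by apply: measurable_funB; [exact: mPsi (lZ n)|exact: mPsi (lW n)].
pose bad n (X : edge n -> T n -> R) := [set w | rate alpha n <=
  `|Psi (K n) (X ^~ w) - \int[P n]_v Psi (K n) (X ^~ v)|].
have mbad n X E : product_law (P n) X (fun=> E) -> measurable (bad n X).
  move=> lX; rewrite -[bad n X]setTI.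
  apply: (measurable_fun_ler (g := fun w =>
    `|Psi (K n) (X ^~ w) - \int[P n]_v Psi (K n) (X ^~ v)|)) => //.
  apply: measurableT_comp => //.
  by apply: measurable_funB => //; exact: mPsi lX.
have bound n : large alpha n ->
    (P n (~` G n) <= (32 * (1 + M) / cbrt (K n)%:R)%:E)%E.
  move=> ln; have bZ := Psi_deviation ln (lZ n) DM.
  have bW := Psi_deviation ln (lW n) NM.
  have cmp := Psi_expectation_compare DM NM ln (lZ n) (lW n).
  apply: (@le_trans _ _ (P n (bad n (Z n) `|` bad n (W n)))).
    apply: le_measure; rewrite ?inE.
    - exact: measurableC.
    - by apply: measurableU; [exact: mbad (lZ n)|exact: mbad (lW n)].
    move=> w /= /negP; rewrite -ltNge /bad /= => far.
    apply/orP; rewrite -[X in X || _]negbK -[X in _ || X]negbK -negb_and.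
    rewrite -!ltNge; apply/negP => /andP[nZ nW].
    move: far; apply/negP; rewrite -leNgt.
    move: nZ nW cmp; rewrite mulrDl; set c := (1 + _) * _.
    by rewrite !ltr_norml !ler_norml => /andP[? ?] /andP[? ?] /andP[? ?];
      apply/andP; split; lra.
  apply: le_trans (measureU2 _ _ _) _; [exact: mbad (lZ n)|exact: mbad (lW n)|].
  apply: le_trans (leeD bZ bW) _.
  by rewrite -EFinD lee_fin le_eqVlt; apply/orP; left; apply/eqP; ring.
have M0 : 0 <= M.
  have [_ eM _ _] := DM; apply: le_trans eM; apply: Rintegral_ge0 => x _.
  exact: expR_ge0.
apply/fine_cvgP; split; first by apply: nearW => n; exact: fin_num_measure.
apply/cvgrPdist_le => eps eps0.
(* The level that the cube root of K has to exceed. *)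
pose x := 32 * (1 + M) / eps.
have x0 : 0 <= x.
  apply: mulr_ge0; last by rewrite invr_ge0 ltW.
  by apply: mulr_ge0; [exact: ler0n|rewrite addr_ge0].
near=> n.
have ln : large alpha n by near: n; exact: large_eventually.
have xK : x <= cbrt (K n)%:R.
  have [_ _ lK _] := ln; apply: cbrt_ge => //; apply: le_trans lK.
  by near: n; exact: ln_eventually_ge.
have K0 : 0 < cbrt ((K n)%:R : R).
  have [_ l1 lK _] := ln; apply: cbrt_gt0.
  by apply: lt_le_trans lK; apply: lt_le_trans l1.
have PC : (P n (~` G n) <= eps%:E)%E.
  apply: le_trans (bound n ln) _; rewrite lee_fin ler_pdivrMr//.
  by rewrite [leRHS]mulrC -ler_pdivrMr.
have Pfin : P n (G n) \is a fin_num by exact: fin_num_measure.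
have P1 : (P n (G n) <= 1)%E by exact: probability_le1.
move: PC P1; rewrite probability_setC// -[P n (G n)]fineK//.
rewrite -EFinB !lee_fin => PC P1.
by rewrite ger0_norm ?subr_ge0.
Unshelve. all: by end_near. Qed.

End Conclusion.

Theorem theorem2p10 (R : realType) (alpha : R) (alpha_gt0 : 0 < alpha)
    (alpha_lt1 : alpha < 1) (D : probability (measurableTypeR R) R)
    (D_subgauss : sub_gaussian D)
    (D_mean : ('E_D[fun x : R => x] = (1 / 2)%:E)%E)
    (D_moment2 : ('E_D[fun x : R => (x ^+ 2)%R] = (1 / 2)%:E)%E) :
  (exists C : R, \forall n \near \oo,
    forall (d1 d2 : measure_display)
      (T1 : measurableType d1) (T2 : measurableType d2)
      (P1 : probability T1 R) (P2 : probability T2 R)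
      (Z : edge n -> {RV P1 >-> R}) (W : edge n -> {RV P2 >-> R}),
      iid Z D -> iid W (normal_half_quarter R) ->
      (`| 'E_P1[fun w => Psi (Ksize alpha n) (fun e => Z e w)]
          - 'E_P2[fun w => Psi (Ksize alpha n) (fun e => W e w)] |
       <= (C * rate alpha n)%:E)%E)
  /\
  (law_of_bounded_rv D ->
   exists C : R,
    forall (d : nat -> measure_display) (T : forall n, measurableType (d n))
      (P : forall n, probability (T n) R)
      (Z W : forall n, edge n -> {RV (P n) >-> R}),
      (forall n, iid (Z n) D) ->
      (forall n, iid (W n) (normal_half_quarter R)) ->
      P n [set w | (`| Psi (Ksize alpha n) (fun e => Z n e w)
                       - Psi (Ksize alpha n) (fun e => W n e w) |
                    <= C * rate alpha n)%R] @[n --> \oo] --> 1%E).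
Proof.
pose N := normal_half_quarter R.
pose M := Num.max (\int[D]_x exp2 x) (\int[N]_x exp2 x).
have DM : moment_class M D.
  apply: moment_class_of_expectation => //.
    exact: sub_gaussian_integrable_exp2.
  by rewrite /M le_max lexx.
have NM : moment_class M N.
  have [m1 m2] := normal_mean_moment2 (R := R).
  split => //; first exact: normal_integrable_exp2.
  by rewrite /M le_max lexx orbT.
split=> [|_].
  exists (1 + 432 * M); near=> n => d1 d2 T1 T2 P1 P2 Z W iidZ iidW.
  have ln : large alpha n by near: n; exact: large_eventually.
  have lZ := product_law_iid iidZ; have lW := product_law_iid iidW.
  have := expectation_Psi ln lZ DM; have := expectation_Psi ln lW NM.
  move=> /= -> ->; rewrite -EFinB lee_fin.
  exact: (Psi_expectation_compare DM NM ln lZ lW).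
exists (1 + 432 * M + 2) => d T P Z W iidZ iidW.
exact: (Psi_close_probability DM NM alpha_gt0 alpha_lt1
  (fun n => product_law_iid (iidZ n)) (fun n => product_law_iid (iidW n))).
Unshelve. all: by end_near. Qed.
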